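(* Let $F_{\alpha,\beta}=\{f^n_{\alpha(n),\beta(n)}\}_{n\in\mathbb{N}_0}$ be a Fučík system for the Neumann Laplacian on $(0,\pi)$. Let $C,\varepsilon>0$ be fixed. If the mappings $\alpha$ and $\beta$ satisfy $$\max(\sqrt{\alpha(n)},\sqrt{\beta(n)})\le n+C\,n^{(1-\varepsilon)/2}$$ for every $n\in\mathbb{N}$, then $F_{\alpha,\beta}$ is a Riesz basis in $L^2(0,\pi)$.
   Context: $L^2(0,\pi)$ is the real Hilbert space with standard scalar product $\langle u,v\rangle=\int_0^\pi uv\,dx$ and norm $\|\cdot\|$; $\mathbb{N}=\{1,2,\dots\}$, $\mathbb{N}_0=\mathbb{N}\cup\{0\}$. For $n\in\mathbb{N}$ let $\Gamma_n=\{(\alpha,\beta): \alpha,\beta>0,\ \frac n2\frac{\pi}{\sqrt\alpha}+\frac n2\frac{\pi}{\sqrt\beta}=\pi\}$. For $(\alpha,\beta)\in\Gamma_n$, the normalized Fučík eigenfunction $f^n_{\alpha,\beta}$ is the $C^2$-solution of $-u''=\alpha u^+-\beta u^-$ in $(0,\pi)$, $u'(0)=u'(\pi)=0$ (where $u^\pm=\max\{\pm u,0\}$) with $f^n_{\alpha,\beta}(0)>0$ and $\sup_{[0,\pi]}|f^n_{\alpha,\beta}|=1$. Explicitly, with $l_1=\pi/\sqrt\alpha$, $l_2=\pi/\sqrt\beta$, $l=l_1+l_2=2\pi/n$, $k\in\mathbb{Z}$: if $\alpha\ge n^2\ge\beta$, then $f^n_{\alpha,\beta}(x)=\frac{\sqrt\beta}{\sqrt\alpha}\cos(\sqrt\alpha(x-kl))$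 for $kl-\frac{l_1}{2}\le x<kl+\frac{l_1}{2}$ and $f^n_{\alpha,\beta}(x)=-\cos(\sqrt\beta(x-\frac{2k+1}{2}l))$ for $\frac{2k+1}{2}l-\frac{l_2}{2}\le x<\frac{2k+1}{2}l+\frac{l_2}{2}$; if $\beta>n^2>\alpha$, then on the same intervals $f^n_{\alpha,\beta}(x)=\cos(\sqrt\alpha(x-kl))$ and $f^n_{\alpha,\beta}(x)=-\frac{\sqrt\alpha}{\sqrt\beta}\cos(\sqrt\beta(x-\frac{2k+1}{2}l))$, respectively. For $n=0$ set $f^0_{\alpha,\beta}\equiv\frac{\sqrt2}{2}$. A Fučík system is a sequence $F_{\alpha,\beta}=\{f^n_{\alpha(n),\beta(n)}\}_{n\in\mathbb{N}_0}$ where $\alpha,\beta:\mathbb{N}_0\to\mathbb{R}$ satisfy $\alpha(0)=\beta(0)=0$ and $(\alpha(n),\beta(n))\in\Gamma_n$ for every $n\ge1$. A sequence in a Hilbert space $H$ is a Riesz basis in $H$ if it is the image of a complete orthonormal system of $H$ under some linear homeomorphism of $H$. *)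

(* Defs.v *)
From HB Require Import structures.
From mathcomp Require Import all_boot all_order all_algebra sesquilinear.
From mathcomp Require Import all_classical all_reals all_analysis.
From mathcomp Require Import measurable_realfun.

Set Implicit Arguments.
Unset Strict Implicit.
Unset Printing Implicit Defensive.

Import Order.TTheory GRing.Theory Num.Theory.
Import numFieldNormedType.Exports.

Local Open Scope classical_set_scope.
Local Open Scope quotient_scope.
Local Open Scope ring_scope.

Section L2_quotient.
Context d (T : measurableType d) (R : realType).
Variable mu : {measure set T -> \bar R}.

(* The library's quotient of the square integrable functions by equality almost
   everywhere, which comes without algebraic structure or norm. *)
Definition L2 : Type := LspaceType2 mu.

HB.instance Definition _ := gen_eqMixin L2.
HB.instance Definition _ := gen_choiceMixin L2.

Notation mq := (@aeEqMfun _ _ R T (measurableTypeR R) mu).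

Definition L2_fun (u : L2) : T -> R := (u : mq).
Coercion L2_fun : L2 >-> Funclass.

Lemma L2_Lfun (u : L2) : (u : T -> R) \in Lfun mu 2%:E.
Proof.
rewrite inE; apply/andP; split; rewrite inE /=.
  exact: (@measurable_funPT _ _ _ _ (repr (u : mq))).
exact: (@Lebesgue_finite _ _ _ _ _ _ u).
Qed.

Lemma L2_measurable (u : L2) : measurable_fun setT (u : T -> R).
Proof. by have := L2_Lfun u; rewrite inE => /andP[]; rewrite inE. Qed.

Lemma L2P (u v : L2) : ((u : T -> R) = v %[ae mu]) <-> (u = v).
Proof.
split=> [uv|->]; last exact: ae_eq_refl.
case: u v uv => [u [[Hu]]] [v [[Hv]]] uv.
have uv' : u = v.
  by apply/eqP; rewrite -[u]reprK -[v]reprK; apply/eqP/eqquotP/asboolP; exact: uv.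
case: _ / uv' in Hv uv *.
by rewrite (Prop_irrelevance Hu Hv).
Qed.

Lemma ae_eq_Lnorm2 (f g : T -> R) :
  measurable_fun setT f -> measurable_fun setT g -> f = g %[ae mu] ->
  'N[mu]_(2%:E)[EFin \o f]%E = 'N[mu]_(2%:E)[EFin \o g]%E.
Proof.
move=> mf mg fg.
have m2 h : measurable_fun setT (h : T -> R) ->
    measurable_fun setT ((fun x => `|(EFin \o h) x| `^ 2)%E : T -> \bar R).
  move=> mh; apply: (@measurableT_comp _ _ _ _ _ _ (fun x : \bar R => x `^ 2)%E).
    exact: measurable_poweR.
  by apply: measurableT_comp => //; exact/measurable_EFinP.
rewrite unlock /Lnorm; congr (_ `^ _)%E.
apply: ae_eq_integral => //; [exact: m2|exact: m2|].
by apply: filterS fg => x /= fg _; rewrite fg.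
Qed.

Lemma L2_of_subproof (f : T -> R) : f \in Lfun mu 2%:E ->
  exists u : L2, (u : T -> R) = f %[ae mu].
Proof.
rewrite inE => /andP[]; rewrite !inE /= => fm ffin.
pose F : {mfun T >-> measurableTypeR R} :=
  @mfun_Sub _ _ T (measurableTypeR R) f (mem_set fm).
pose q : mq := \pi_mq F.
have qE : (q : T -> R) = f %[ae mu].
  have : repr q = F %[mod mq] by rewrite reprK.
  by move=> /eqquotP/asboolP.
have qfin : finite_norm mu 2%:E (q : T -> R).
  rewrite /finite_norm (ae_eq_Lnorm2 _ fm qE)//.
  exact: (@measurable_funPT _ _ _ _ (repr q)).
pose c := isFinLebesgue.Build _ _ _ _ _ (lee1n 2) q qfin.
by exists (LebesgueSpace.Pack (LebesgueSpace.Class c)).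
Qed.

Lemma Lfun0 : (cst 0 : T -> R) \in Lfun mu 2%:E.
Proof. exact: (LfunP (cst 0 : LfunType mu (lee1n 2))). Qed.

(* The class of [f] when [f] is measurable and square integrable for [mu]; the
   class of [0] otherwise. *)
Definition L2_of (f : T -> R) : L2 :=
  if pselect (f \in Lfun mu 2%:E) is left fL
  then sval (cid (L2_of_subproof fL))
  else sval (cid (L2_of_subproof Lfun0)).

Lemma L2_ofE (f : T -> R) : f \in Lfun mu 2%:E -> (L2_of f : T -> R) = f %[ae mu].
Proof.
by move=> fL; rewrite /L2_of; case: pselect => // fL'; case: cid.
Qed.

Definition L2_zero : L2 := L2_of (cst 0).
Definition L2_add (u v : L2) : L2 := L2_of (u \+ v).
Definition L2_opp (u : L2) : L2 := L2_of (\- u).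
Definition L2_scale (a : R) (u : L2) : L2 := L2_of (fun x => a * u x).

Lemma L2_zeroE : (L2_zero : T -> R) = cst 0 %[ae mu].
Proof. exact/L2_ofE/Lfun0. Qed.

Lemma L2_addE (u v : L2) : (L2_add u v : T -> R) = u \+ v %[ae mu].
Proof. by apply: L2_ofE; apply: (Lfun_addr_closed mu (lee1n 2)).2; exact: L2_Lfun. Qed.

Lemma L2_oppE (u : L2) : (L2_opp u : T -> R) = \- u %[ae mu].
Proof. by apply: L2_ofE; apply: (@Lfun_oppr_closed _ _ _ mu 2%:E); exact: L2_Lfun. Qed.

Lemma L2_scaleE a (u : L2) : (L2_scale a u : T -> R) = (fun x => a * u x) %[ae mu].
Proof.
apply: L2_ofE; rewrite (_ : (fun x => _) = a \o* u).
  by apply: Lfun_scale; [exact: ler1n|exact: L2_Lfun].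
by apply/funext => x /=; rewrite mulrC.
Qed.

Let L2_addA : associative L2_add.
Proof.
move=> u v w; apply/L2P.
have h1 := L2_addE u (L2_add v w); have h2 := L2_addE v w.
have h3 := L2_addE (L2_add u v) w; have h4 := L2_addE u v.
apply: filterS2 (filterI h1 h2) (filterI h3 h4) => x /= [] a b [] c e _.
by rewrite a// b// c// e//= addrA.
Qed.

Let L2_addC : commutative L2_add.
Proof.
move=> u v; apply/L2P.
apply: filterS2 (L2_addE u v) (L2_addE v u) => x /= a b _.
by rewrite a// b//= addrC.
Qed.

Let L2_add0 : left_id L2_zero L2_add.
Proof.
move=> u; apply/L2P.
apply: filterS2 (L2_addE L2_zero u) L2_zeroE => x /= a b _.
by rewrite a//= b//= add0r.
Qed.

Let L2_addN : left_inverse L2_zero L2_opp L2_add.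
Proof.
move=> u; apply/L2P.
apply: filterS3 (L2_addE (L2_opp u) u) L2_zeroE (L2_oppE u) => x /= a b c _.
by rewrite a//= b//= c//= addNr.
Qed.

HB.instance Definition _ :=
  GRing.isZmodule.Build L2 L2_addA L2_addC L2_add0 L2_addN.

Let L2_scaleA a b (u : L2) : L2_scale a (L2_scale b u) = L2_scale (a * b) u.
Proof.
apply/L2P; apply: filterS3 (L2_scaleE a (L2_scale b u)) (L2_scaleE b u)
  (L2_scaleE (a * b) u) => x /= h1 h2 h3 _.
by rewrite h1// h2// h3// mulrA.
Qed.

Let L2_scale1 : left_id 1 L2_scale.
Proof.
by move=> u; apply/L2P; apply: filterS (L2_scaleE 1 u) => x /= h _; rewrite h// mul1r.
Qed.

Let L2_scaleDr : right_distributive L2_scale L2_add.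
Proof.
move=> a u v; apply/L2P.
have h1 := L2_scaleE a (L2_add u v); have h2 := L2_addE u v.
have h3 := L2_addE (L2_scale a u) (L2_scale a v).
have h4 := L2_scaleE a u; have h5 := L2_scaleE a v.
apply: filterS3 (filterI h1 h2) h3 (filterI h4 h5) => x /= [] p1 p2 p3 [] p4 p5 _.
by rewrite p1// p2// p3//= p4// p5// mulrDr.
Qed.

Let L2_scaleDl (u : L2) :
  {morph L2_scale^~ u : a b / a + b >-> L2_add a b}.
Proof.
move=> a b; apply/L2P.
have h1 := L2_scaleE (a + b) u.
have h3 := L2_addE (L2_scale a u) (L2_scale b u).
have h4 := L2_scaleE a u; have h5 := L2_scaleE b u.
apply: filterS3 h1 h3 (filterI h4 h5) => x /= p1 p3 [] p4 p5 _.
by rewrite p1// p3//= p4// p5// mulrDl.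
Qed.

HB.instance Definition _ := GRing.Zmodule_isLmodule.Build R L2
  L2_scaleA L2_scale1 L2_scaleDr L2_scaleDl.

Lemma L2_0E : ((0 : L2) : T -> R) = cst 0 %[ae mu]. Proof. exact: L2_zeroE. Qed.
Lemma L2_DE (u v : L2) : ((u + v : L2) : T -> R) = u \+ v %[ae mu].
Proof. exact: L2_addE. Qed.
Lemma L2_ZE a (u : L2) : ((a *: u : L2) : T -> R) = (fun x => a * u x) %[ae mu].
Proof. exact: L2_scaleE. Qed.

Definition L2_norm (u : L2) : R := fine ('N[mu]_(2%:E)[EFin \o u])%E.

Let lf (u : L2) : LfunType mu (lee1n 2) := Lfun_Sub (lee1n 2) (L2_Lfun u).

Let L2_ler_normD (u v : L2) : L2_norm (u + v) <= L2_norm u + L2_norm v.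
Proof.
apply: le_trans (ler_LnormD (lf u) (lf v)); rewrite le_eqVlt; apply/orP; left.
apply/eqP; congr fine; apply: ae_eq_Lnorm2 (L2_DE u v); first exact: L2_measurable.
by apply: measurable_funD; exact: L2_measurable.
Qed.

Let L2_normrZ a (u : L2) : L2_norm (a *: u) = `|a| * L2_norm u.
Proof.
rewrite /L2_norm (ae_eq_Lnorm2 _ _ (L2_ZE a u)); last 2 first.
- exact: L2_measurable.
- by apply: measurable_funM => //; exact: L2_measurable.
have := LnormZ (lf u) a; rewrite -(finite_norm_fine (lf u)) => h.
rewrite [X in fine X](_ : _ = (`|a| * L2_norm u)%:E)//.
Qed.

Let L2_normr0_eq0 (u : L2) : L2_norm u = 0 -> u = 0.
Proof.
move=> /(fine_Lnormr_eq0 (f := lf u)) u0; apply/L2P.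
by apply: filterS2 u0 L2_0E => x h1 h2 _; rewrite h2//; exact: h1.
Qed.

HB.instance Definition _ := Lmodule_isNormed.Build R L2
  L2_ler_normD L2_normrZ L2_normr0_eq0.

Definition L2_dot (u v : L2) : R := \int[mu]_x (u x * v x).

Let intM (u v : L2) : mu.-integrable setT (EFin \o (fun x => u x * v x)).
Proof.
by apply/Lfun1_integrable; apply: Lfun2_mul_Lfun1; exact: L2_Lfun.
Qed.

Let ae_dot (f g : T -> R) : measurable_fun setT f -> measurable_fun setT g ->
  f = g %[ae mu] -> \int[mu]_x f x = \int[mu]_x g x.
Proof.
move=> mf mg fg; congr fine; apply: ae_eq_integral => //.
- exact/measurable_EFinP.
- exact/measurable_EFinP.
- by apply: filterS fg => x /= h _; rewrite h.
Qed.

Lemma L2_dotC u v : L2_dot u v = L2_dot v u.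
Proof. by apply: eq_Rintegral => x _; rewrite mulrC. Qed.

Lemma L2_dotDl u v w : L2_dot (u + v) w = L2_dot u w + L2_dot v w.
Proof.
rewrite /L2_dot -RintegralD//; try exact: intM.
apply: ae_dot.
- by apply: measurable_funM; exact: L2_measurable.
- by apply: measurable_funD; apply: measurable_funM; exact: L2_measurable.
- by apply: filterS (L2_DE u v) => x /= h _; rewrite h//= mulrDl.
Qed.

Lemma L2_dotZl a u v : L2_dot (a *: u) v = a * L2_dot u v.
Proof.
rewrite /L2_dot -RintegralZl//; try exact: intM.
apply: ae_dot.
- by apply: measurable_funM; exact: L2_measurable.
- by apply: measurable_funM => //; apply: measurable_funM; exact: L2_measurable.
- by apply: filterS (L2_ZE a u) => x /= h _; rewrite h//= mulrA.
Qed.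

Lemma L2_normE (u : L2) : `|u| ^+ 2 = L2_dot u u.
Proof.
rewrite -[`|u|]/(L2_norm u) -powR_mulrn; last first.
  by rewrite fine_ge0// Lnorm_ge0.
apply: EFin_inj; rewrite -poweR_EFin (finite_norm_fine (lf u)).
rewrite poweR_Lnorm ?pnatr_eq0// /L2_dot /Rintegral fineK//; last first.
  by apply: integrable_fin_num => //; exact: intM.
apply: eq_integral => x _ /=; rewrite powR_mulrn//.
by rewrite -normrX ger0_norm ?sqr_ge0// expr2.
Qed.

Let L2_dot_bilinear :
  bilinear_for ( *%R : GRing.Scale.law R R) ( *%R : GRing.Scale.law R R) L2_dot.
Proof.
split=> u a v w; first by rewrite L2_dotDl L2_dotZl.
by rewrite L2_dotC L2_dotDl L2_dotZl ![L2_dot _ u]L2_dotC.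
Qed.

HB.instance Definition _ := @bilinear_isBilinear.Build R L2 L2 R
  *%R *%R L2_dot L2_dot_bilinear.

Let L2_dot_hermitian (u v : L2) :
  L2_dot u v = (-1) ^+ false * idfun (L2_dot v u).
Proof. by rewrite expr0 mul1r L2_dotC. Qed.

HB.instance Definition _ := @isHermitianSesquilinear.Build R L2 false idfun
  L2_dot L2_dot_hermitian.

Let L2_dot_gt0 (u : L2) : u != 0 -> 0 < L2_dot u u.
Proof. by move=> u0; rewrite -L2_normE exprn_gt0// normr_gt0. Qed.

HB.instance Definition _ := @isDotProduct.Build R L2 L2_dot L2_dot_gt0.

End L2_quotient.

(* [dot] is to be an inner product inducing the norm of [H]; for [L2] this is
   [L2_normE]. *)
Section riesz_basis.
Context (R : realType) (H : normedModType R) (dot : {dot H for idfun}).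

Definition orthonormal_system (e : nat -> H) : Prop :=
  forall i j, dot (e i) (e j) = (i == j)%:R.

Definition complete_system (e : nat -> H) : Prop :=
  dense [set v | exists n (c : 'I_n -> R), v = \sum_(i < n) c i *: e i].

Definition linear_homeomorphism (A : H -> H) : Prop :=
  linear A /\
  exists B : H -> H, [/\ cancel A B, cancel B A, continuous A & continuous B].

Definition riesz_basis (f : nat -> H) : Prop :=
  exists (e : nat -> H) (A : H -> H),
    [/\ orthonormal_system e, complete_system e, linear_homeomorphism A
      & forall n, f n = A (e n)].

End riesz_basis.

Section L2_0pi.
Context (R : realType).

Definition lebesgue_0pi : {measure set (measurableTypeR R) -> \bar R} :=
  mrestr (@lebesgue_measure R) (measurable_itv `]0, (pi : R)[).

Definition L2_0pi := L2 lebesgue_0pi.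

Definition L2_0pi_of (f : R -> R) : L2_0pi :=
  L2_of lebesgue_0pi (f \_ `]0, (pi : R)[).

Lemma L2_0pi_dotE (u v : L2_0pi) :
  L2_dot u v = \int[@lebesgue_measure R]_(x in `]0, (pi : R)[) (u x * v x).
Proof.
have mI : measurable (`]0, (pi : R)[%classic : set (measurableTypeR R)).
  exact: measurable_itv.
congr fine; rewrite (@negligible_integral _ (measurableTypeR R) _ lebesgue_0pi setT (~` `]0, (pi : R)[%classic))//.
- rewrite setTD setCK; apply: eq_measure_integral => A mA AD.
  by rewrite /= /mrestr setIidl.
- exact: measurableC.
- by apply/Lfun1_integrable; apply: Lfun2_mul_Lfun1; exact: L2_Lfun.
- by rewrite /= /mrestr setICl measure0.
Qed.

End L2_0pi.

Section fucik.
Context (R : realType).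
Implicit Types (n : nat) (a b : R) (u : R -> R).

Definition fucik_Gamma n a b : Prop :=
  [/\ 0 < a, 0 < b &
    n%:R / 2 * (pi / Num.sqrt a) + n%:R / 2 * (pi / Num.sqrt b) = pi].

(* C^2-regularity is meant up to the boundary: the equation extends [u'']
   continuously to the closed interval, and the Neumann conditions are read off
   the one-sided limits of [u']. *)
Definition fucik_neumann_solution a b u : Prop :=
  [/\ {within `[0, pi], continuous u},
      {in `]0, pi[, forall x, derivable u x 1 /\ derivable (derive1 u) x 1},
      {in `]0, pi[, continuous (derive1n 2 u)},
      {in `]0, pi[, forall x,
        - derive1n 2 u x = a * Num.max (u x) 0 - b * Num.max (- u x) 0}
    & derive1 u x @[x --> 0^'+] --> 0 /\ derive1 u x @[x --> pi^'-] --> 0].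

Definition fucik_eigenfunction a b u : Prop :=
  [/\ fucik_neumann_solution a b u, 0 < u 0
    & sup [set `|u x| | x in `[0, pi]] = 1].

Definition fucik_system (alpha beta : nat -> R) (f : nat -> R -> R) : Prop :=
  [/\ alpha 0%N = 0 /\ beta 0%N = 0,
      forall n, (1 <= n)%N -> fucik_Gamma n (alpha n) (beta n),
      {in `[0, pi], forall x, f 0%N x = Num.sqrt 2 / 2}
    & forall n, (1 <= n)%N -> fucik_eigenfunction (alpha n) (beta n) (f n)].

End fucik.

(* Main.v *)
From HB Require Import structures.
Require Import Defs.
From mathcomp Require Import all_boot all_order all_algebra sesquilinear.
From mathcomp Require Import all_classical all_reals all_analysis.
From mathcomp Require Import measurable_realfun ring lra.

(* Let e_0 = 1/sqrt pi, e_n = sqrt (2/pi) cos (n x), and let s = sqrt (pi/2). On (0, pi) the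
   eigenfunction f^n is the restriction of an even function of period 2 pi/n, so its cosine
   expansion only involves the frequencies 0, n, 2n, ...: hence <f^n, e_m> = 0 for
   0 < m < n, while <f^n, e_n> > 0 because f^n decreases on [0, pi/n]. Moreover
   |f^n - cos (n x)| <= (2 + pi) (max (sqrt alpha, sqrt beta) - n)/n = O(n^(-(1+eps)/2)), so
   d_n = f^n/s - e_n is square summable. The operators
   T_N v = v + sum_(n >= N) <v, e_n> d_n are invertible for large N by a Neumann series, and
   T_m = T_(m+1) + <., e_m> d_m is a rank one perturbation of T_(m+1) that is invertible
   exactly when <f^m, e_m> <> 0, by the triangular structure. So T_0 is invertible, and
   f^n = s T_0 e_n. *)

Set Implicit Arguments.
Unset Strict Implicit.
Unset Printing Implicit Defensive.

Import Order.TTheory GRing.Theory Num.Theory.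
Import numFieldNormedType.Exports.

Local Open Scope classical_set_scope.
Local Open Scope ring_scope.

(** * Triangular perturbations of an orthonormal system *)

(** A Neumann series alone cannot do it: as [C] is arbitrary, the sum of the [|d_n|^2] is finite but
    not small, so only a tail operator is close to the identity, and the finitely many remaining
    indices are handled by algebra. That algebra ignores the size of [d_n]; it sees only which
    coefficients vanish. Frequency 0 breaks the triangular pattern, since an eigenfunction with
    [alpha <> beta] has nonzero mean. No update is made there, however: the value [sqrt 2 / 2] of
    [f^0] equals [s / sqrt pi], so [d_0 = 0] exactly. The eigenfunctions are given by a boundary
    value problem and not by a formula. Uniqueness for the initial value problem turns the equation
    into an explicit profile on a half period, and symmetry of the solution about the critical
    points spreads it over the interval. Only then are evenness, periodicity and monotonicity
    available. The size of [d_n] is controlled by the larger of the two frequencies alone because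
    [n] is the harmonic mean of [sqrt alpha] and [sqrt beta]. *)

Section bounded_invertible.
Context (R : realType) (H : normedModType R).
Implicit Types A B : H -> H.

Definition bounded_linear A : Prop :=
  linear A /\ exists M : R, forall v, `|A v| <= M * `|v|.

Definition bounded_invertible A : Prop :=
  bounded_linear A /\
  exists B, [/\ cancel A B, cancel B A & exists M : R, forall v, `|B v| <= M * `|v|].

Lemma bounded_linear_continuous_fun A : bounded_linear A -> continuous A.
Proof.
move=> [lA [M AM]] x.
pose L : {linear H -> H} := HB.pack A (GRing.isLinear.Build _ _ _ _ A lA).
apply: (@bounded_linear_continuous _ _ _ L).
apply/linear_boundedP; near=> r => y.
apply: (le_trans (AM y)); apply: ler_wpM2r => //.
Unshelve. all: by end_near. Qed.

Lemma bounded_invertible_homeomorphism A :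
  bounded_invertible A -> linear_homeomorphism A.
Proof.
move=> [bA [B [AK BK BM]]]; split; first exact: bA.1.
exists B; split => //; first exact: bounded_linear_continuous_fun.
apply: bounded_linear_continuous_fun; split => // a u v.
by apply: (can_inj AK); rewrite bA.1 !BK.
Qed.

Lemma bounded_invertible_scale A (s : R) : s != 0 ->
  bounded_invertible A -> bounded_invertible (fun v => s *: A v).
Proof.
move=> s0 [[lA [M AM]] [B [AK BK [M' BM]]]].
split; first split.
- by move=> a u v; rewrite lA scalerDr !scalerA mulrC.
- by exists (`|s| * M) => v; rewrite normrZ -mulrA ler_wpM2l.
exists (fun v => B (s^-1 *: v)); split.
- by move=> v; rewrite scalerA mulVf// scale1r AK.
- by move=> v; rewrite BK scalerA mulfV// scale1r.
- exists (M' * `|s^-1|) => v; apply: (le_trans (BM _)).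
  by rewrite normrZ mulrA.
Qed.

End bounded_invertible.

(** * Inverting a perturbation of the identity by a Neumann series *)

Section neumann.
Context (R : realType) (H : completeNormedModType R).

Lemma bounded_invertible_near_id (A : H -> H) (q : R) :
  linear A -> 0 <= q < 1 -> (forall v, `|A v - v| <= q * `|v|) ->
  bounded_invertible A.
Proof.
move=> lA /andP[q0 q1] Aq.
have bA : bounded_linear A.
  split => //; exists (1 + q) => v.
  rewrite -[A v](subrK v); apply: (le_trans (ler_normD _ _)).
  by rewrite mulrDl mul1r addrC lerD2l.
pose K v := v - A v.
have lK : linear K.
  by move=> a u v; rewrite /K lA opprD addrACA -scalerN -scalerDr.
have Kq v : `|K v| <= q * `|v| by rewrite /K distrC.
have itK n w : `|iter n K w| <= q ^+ n * `|w|.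
  elim: n => [|n IH]; first by rewrite expr0 mul1r.
  by rewrite iterS (le_trans (Kq _))// exprS -mulrA ler_wpM2l.
have cvgK w : cvgn (series (fun n => iter n K w)).
  apply: normed_cvg.
  apply: (@series_le_cvg _ (fun n => `|iter n K w|) (fun n => `|w| * q ^+ n)).
  - by move=> n; exact: normr_ge0.
  - by move=> n; rewrite mulr_ge0// exprn_ge0.
  - by move=> n; rewrite mulrC.
  - by apply: is_cvg_geometric_series; rewrite ger0_norm.
pose B w := limn (series (fun n => iter n K w)).
have cA : continuous A by exact: bounded_linear_continuous_fun.
pose LA : {linear H -> H} := HB.pack A (GRing.isLinear.Build _ _ _ _ A lA).
have BK : cancel B A.
  move=> w.
  have h1 : A (series (fun n => iter n K w) n) @[n --> \oo] --> A (B w).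
    exact: (cvg_comp _ _ (cvgK w) (cA _)).
  have h2 : A (series (fun n => iter n K w) n) @[n --> \oo] --> w.
    (* As [A = 1 - K], applying [A] to the partial sums of the series telescopes. *)
    have E n : A (series (fun n => iter n K w) n) = w - iter n K w.
      rewrite /series /= -[A _]/(LA _) raddf_sum.
      transitivity (\sum_(0 <= k < n) (iter k K w - iter k.+1 K w)).
        by apply: eq_bigr => k _; rewrite /= /K opprB addrC subrK.
      elim: n => [|n IH]; first by rewrite big_nil subrr.
      by rewrite big_nat_recr// IH/= addrA subrK.
    rewrite (funext E) -[X in _ --> X]subr0.
    exact: (cvgB (cvg_cst w) (cvg_series_cvg_0 (cvgK w))).
  exact: (cvg_unique (@norm_hausdorff _ _) h1 h2).
(* This lower bound gives both the injectivity of [A], hence the other cancellation, and the bound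
   on the inverse. *)
have low v : (1 - q) * `|v| <= `|A v|.
  rewrite mulrBl mul1r lerBlDr -{1}[v](subrK (A v)) addrC.
  by apply: (le_trans (ler_normD _ _)); rewrite lerD2l; exact: Kq.
have q1' : 0 < 1 - q by rewrite subr_gt0.
have injA : injective A.
  move=> u v uv; apply/eqP; rewrite -subr_eq0 -normr_le0.
  have := low (u - v); rewrite -[A _]/(LA _) raddfB /= uv subrr normr0.
  by rewrite pmulr_rle0.
split => //; exists B; split => //.
- by move=> v; apply: injA; rewrite BK.
- exists (1 - q)^-1 => v; rewrite mulrC ler_pdivlMr// mulrC.
  by rewrite (le_trans (low _))// BK.
Qed.

End neumann.

(** * Bessel, orthonormal expansions and rank one updates *)

Section hilbert.
Context (R : realType) (H : completeNormedModType R) (dot : {dot H for idfun}).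
Hypothesis dot_norm : forall u : H, `|u| ^+ 2 = dot u u.
Implicit Types e d g : nat -> H.

Let dotC u v : dot u v = dot v u.
Proof. by rewrite [LHS](hermC dot) expr0 mul1r. Qed.

Lemma dot_sub_sqr u v a :
  `|u - a *: v| ^+ 2 = `|u| ^+ 2 - a * dot u v *+ 2 + a ^+ 2 * `|v| ^+ 2.
Proof.
rewrite !dot_norm linearBl !linearBr/= !linearZl_LR/= !linearZr_LR/=.
by rewrite (dotC v u); ring.
Qed.

Lemma dot_le u v : `|v| = 1 -> `|dot u v| <= `|u|.
Proof.
move=> v1; rewrite -(@ler_pXn2r _ 2)// ?nnegrE// real_normK ?num_real//.
have := sqr_ge0 `|u - dot u v *: v|; rewrite dot_sub_sqr v1; nra.
Qed.

Lemma dot_continuous v : `|v| = 1 -> continuous (dot ^~ v).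
Proof.
move=> v1 u; apply/cvgrPdist_lt => e e0; near=> w.
rewrite -linearBl/= (le_lt_trans (dot_le _ v1))//.
Unshelve. all: by end_near. Qed.

Lemma cvg_dot (u_ : nat -> H) u v : `|v| = 1 ->
  u_ n @[n --> \oo] --> u -> dot (u_ n) v @[n --> \oo] --> dot u v.
Proof.
move=> v1 uu.
exact: (@cvg_comp _ _ _ u_ (dot ^~ v) _ _ _ uu (@dot_continuous v v1 u)).
Qed.

Section orthonormal.
Context (e : nat -> H).
Hypothesis e_on : orthonormal_system dot e.

Let e1 n : `|e n| = 1.
Proof.
apply/eqP; rewrite -(@eqrXn2 _ 2)// dot_norm e_on eqxx expr1n//.
Qed.

Lemma bessel_residual v n :
  `|v - \sum_(k < n) dot v (e k) *: e k| ^+ 2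
    = `|v| ^+ 2 - \sum_(k < n) dot v (e k) ^+ 2.
Proof.
elim: n => [|n IH]; first by rewrite !big_ord0 !subr0.
rewrite !big_ord_recr/= opprD addrA dot_sub_sqr IH e1 linearBl/=.
rewrite linear_sumlz/= [X in _ * (_ - X)]big1; first by ring.
move=> i _; rewrite linearZl_LR/= e_on.
by rewrite ltn_eqF ?mulr0//; exact: ltn_ord.
Qed.

Lemma bessel v n : \sum_(k < n) dot v (e k) ^+ 2 <= `|v| ^+ 2.
Proof. by rewrite -subr_ge0 -bessel_residual sqr_ge0. Qed.

Lemma bessel_cvg v : cvgn (series (fun n => dot v (e n) ^+ 2)).
Proof.
apply: nondecreasing_is_cvgn.
  by apply: nondecreasing_series => n _ _; exact: sqr_ge0.
exists (`|v| ^+ 2) => _ [n _ <-].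
by rewrite /series/= big_mkord bessel.
Qed.

Lemma norm_sum_orthonormal (c : nat -> R) m n :
  `|\sum_(m <= k < n) c k *: e k| ^+ 2 = \sum_(m <= k < n) c k ^+ 2.
Proof.
elim: n => [|n IH]; first by rewrite !big_geq// normr0 expr0n.
have [mn|mn] := leqP m n; last by rewrite !big_geq// normr0 expr0n.
rewrite !big_nat_recr//=.
rewrite -[X in _ + X]opprK -scaleNr dot_sub_sqr IH e1 linear_sumlz/=.
rewrite [X in _ * X]big_nat_cond [X in _ * X]big1; first by ring.
move=> i /andP[/andP[_ ilt] _]; rewrite linearZl_LR/= e_on ltn_eqF ?mulr0//.
Qed.

(** Bessel makes the series Cauchy, and [v] minus its sum is orthogonal to every [e n], hence zero
    by totality. *)
Lemma orthonormal_expansion v :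
  (forall v, (forall n, dot v (e n) = 0) -> v = 0) ->
  series (fun n => dot v (e n) *: e n) @ \oo --> v.
Proof.
move=> tot.
have cs := @bessel_cvg v.
have cv : cvgn (series (fun n => dot v (e n) *: e n)).
  apply/cauchy_cvgP/cauchy_seriesP => r r0.
  move: cs => /cauchy_cvgP/cauchy_seriesP/(_ (r ^+ 2) (exprn_gt0 _ r0)).
  apply: filterS => n /=; rewrite -norm_sum_orthonormal normrX normr_id.
  by rewrite ltr_pXn2r ?nnegrE//; exact: ltW.
suff E : v = limn (series (fun n => dot v (e n) *: e n)) by rewrite {2}E.
apply/eqP; rewrite -subr_eq0; apply/eqP/tot => n.
rewrite linearBl/=; apply/eqP; rewrite subr_eq0; apply/eqP.
have h1 : dot (series (fun k => dot v (e k) *: e k) m) (e n) @[m --> \oo] -->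
    dot (limn (series (fun k => dot v (e k) *: e k))) (e n).
  exact: cvg_dot.
apply: (cvg_unique (@norm_hausdorff _ _) _ h1).
apply: cvg_near_cst; near=> m.
rewrite /series/= linear_sumlz/=.
have nm : (n < m)%N by near: m; exact: nbhs_infty_gt.
rewrite (bigD1_seq n)/= ?mem_index_iota ?iota_uniq//.
rewrite big1 ?addr0 => [|i ni]; rewrite linearZl_LR/= e_on.
  by rewrite eqxx mulr1.
by rewrite (negbTE ni) mulr0.
Unshelve. all: by end_near. Qed.

Lemma total_complete_system :
  (forall v, (forall n, dot v (e n) = 0) -> v = 0) -> complete_system e.
Proof.
move=> tot O [v Ov] oO.
have /= [N _ /(_ N (leqnn _)) hN] := @orthonormal_expansion v tot O (open_nbhs_nbhs (conj oO Ov)).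
exists (series (fun n => dot v (e n) *: e n) N); split => //.
by exists N, (fun i => dot v (e i)); rewrite /series/= big_mkord.
Qed.

(** Since [S] preserves the coefficient at [e m], the update multiplies that coefficient by
    [1 + dot w (e m)]. It can therefore be read off from the image, after which [S] is inverted. *)
Lemma bounded_invertible_rank1 (S : H -> H) (m : nat) (w : H) :
  bounded_invertible S -> S (e m) = e m ->
  (forall u, dot (S u) (e m) = dot u (e m)) -> 1 + dot w (e m) != 0 ->
  bounded_invertible (fun v => S v + dot v (e m) *: w).
Proof.
move=> [[lS [M SM]] [B [SK BK [M' BM]]]] Sem Sdot w0.
split; first split.
- move=> a u v; rewrite lS linearPl/= scalerDr scalerA.
  by rewrite -!addrA; congr (_ + _); rewrite addrCA scalerDl.
- exists (M + `|w|) => v; apply: (le_trans (ler_normD _ _)).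
  rewrite mulrDl lerD// normrZ mulrC ler_wpM2l//; exact: dot_le.
(* [t v] is the coefficient at [e m] of the preimage of [v]. *)
pose t v := dot v (e m) / (1 + dot w (e m)).
exists (fun v => B (v - t v *: w)); split.
- move=> v; apply: (can_inj SK); rewrite BK {1}/t linearDl/= linearZl_LR/= Sdot.
  set x := dot v (e m).
  by rewrite (_ : x + x * dot w (e m) = x * (1 + dot w (e m))) ?mulfK ?addrK//; ring.
- move=> v; rewrite BK -[in X in _ + X]Sdot BK linearBl/= linearZl_LR/=.
  rewrite (_ : dot v (e m) - t v * dot w (e m) = t v) ?subrK//.
  by rewrite /t; field.
- exists (M' * (1 + `|1 + dot w (e m)|^-1 * `|w|)) => v.
  have M'0 : 0 <= M'.
    have := le_trans (normr_ge0 _) (BM (e m)); rewrite e1 mulr1//.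
  apply: (le_trans (BM _)); rewrite -mulrA ler_wpM2l//.
  apply: (le_trans (ler_normB _ _)); rewrite mulrDl mul1r lerD2l normrZ.
  rewrite mulrAC ler_wpM2r// /t normrM normfV mulrC ler_wpM2l//.
  exact: dot_le.
Qed.

(** Cauchy-Schwarz, from summing [2 p q a b <= q^2 a^2 + p^2 b^2]; the final division is by
    [2 p q]. *)
Lemma sum_mul_le (a b : nat -> R) (p q : R) (m n : nat) : 0 < p -> 0 < q ->
  \sum_(m <= k < n) a k ^+ 2 <= p ^+ 2 -> \sum_(m <= k < n) b k ^+ 2 <= q ^+ 2 ->
  \sum_(m <= k < n) a k * b k <= q * p.
Proof.
move=> p0 q0 ha hb.
rewrite -(@ler_pM2l _ (2 * p * q)); last by rewrite !mulr_gt0.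
apply: (@le_trans _ _ (\sum_(m <= k < n) (q ^+ 2 * a k ^+ 2 + p ^+ 2 * b k ^+ 2))).
  rewrite mulr_sumr; apply: ler_sum => k _.
  by have := sqr_ge0 (q * a k - p * b k); nra.
rewrite big_split/= -!mulr_sumr.
have q2 := ler_wpM2l (sqr_ge0 q) ha; have p2 := ler_wpM2l (sqr_ge0 p) hb.
by apply: (le_trans (lerD q2 p2)); rewrite le_eqVlt; apply/orP; left; apply/eqP; ring.
Qed.

Section perturbation.
Context (d : nat -> H).
Hypothesis d_summable : cvgn (series (fun n => `|d n| ^+ 2)).

Let K v := limn (series (fun n => dot v (e n) *: d n)).

Let K_cvg v : cvgn (series (fun n => dot v (e n) *: d n)).
Proof.
apply: normed_cvg.
apply: (@series_le_cvg _ (fun n => `|dot v (e n) *: d n|)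
  ((fun n => dot v (e n) ^+ 2) + (fun n => `|d n| ^+ 2))).
- by move=> n; exact: normr_ge0.
- by move=> n; rewrite addr_ge0// sqr_ge0.
- move=> n; rewrite !fctE normrZ -(real_normK (num_real (dot v (e n)))).
  have := sqr_ge0 (`|dot v (e n)| - `|d n|).
  have := mulr_ge0 (normr_ge0 (dot v (e n))) (normr_ge0 (d n)).
  nra.
- by apply: is_cvg_seriesD; [exact: bessel_cvg|exact: d_summable].
Qed.

Let K_linear : linear K.
Proof.
move=> a u v; rewrite {1}/K; apply: cvg_lim; first exact: norm_hausdorff.
rewrite (_ : series _ = (fun n => a *: series (fun n => dot u (e n) *: d n) n)
   + series (fun n => dot v (e n) *: d n)).
  by apply: cvgD; [apply: cvgZr; exact: K_cvg|exact: K_cvg].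
apply/funext => n; rewrite /series/= !fctE scaler_sumr -big_split/=.
by apply: eq_bigr => k _; rewrite linearPl/= scalerDl scalerA.
Qed.

(** The tail of [K] from [N] on is written as the full sum minus a partial sum, so that linearity
    comes from [K] and the passage from [N.+1] to [N] is the removal of one term. *)
Let T N v := v + (K v - \sum_(k < N) dot v (e k) *: d k).

Let T_linear N : linear (T N).
Proof.
move=> a u v; rewrite /T K_linear scalerDr [RHS]addrACA; congr (_ + _).
rewrite scalerBr [RHS]addrACA; congr (_ + _).
rewrite -opprD scaler_sumr -big_split/=; congr (- _); apply: eq_bigr => k _.
by rewrite linearPl/= scalerDl scalerA.
Qed.

Let tail_cvg N v :
  (\sum_(N <= k < n) dot v (e k) *: d k) @[n --> \oo] -->
  K v - \sum_(k < N) dot v (e k) *: d k.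
Proof.
apply: (@cvg_trans _ ((series (fun n => dot v (e n) *: d n) n
    - \sum_(k < N) dot v (e k) *: d k) @[n --> \oo])); last first.
  by apply: cvgB; [exact: K_cvg|exact: cvg_cst].
apply: near_eq_cvg; near=> n.
have Nn : (N <= n)%N by near: n; exact: nbhs_infty_ge.
rewrite /series/= (big_cat_nat (leq0n N) Nn)//= big_mkord addrAC subrr add0r.
Unshelve. all: by end_near. Qed.

Let T_invertible_large : exists N, bounded_invertible (T N).
Proof.
(* The Cauchy criterion concerns squared norms; the threshold [(1 / 2) ^+ 2] becomes the contraction
   factor [1 / 2] after Cauchy-Schwarz and Bessel. *)
have q0 : (0 : R) < (1 / 2) ^+ 2 by rewrite exprn_gt0.
have /cauchy_cvgP/cauchy_seriesP/(_ _ q0) := d_summable.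
move=> [[P Q] [/= [N1 _ hP] [N2 _ hQ]] sub].
pose N := maxn N1 N2; exists N.
apply: (@bounded_invertible_near_id _ _ _ (1 / 2)); [exact: T_linear|lra|].
move=> v; rewrite /T addrAC subrr add0r.
(* The case [v = 0] is separate because [sum_mul_le] is applied with [p] equal to the norm of [v],
   which must be positive. *)
have [->|v0] := eqVneq v 0.
  rewrite normr0 mulr0 normr_le0; apply/eqP.
  apply: (cvg_unique (@norm_hausdorff _ H) (@tail_cvg N 0)).
  by apply: cvg_near_cst; near=> n; rewrite big1// => k _; rewrite linear0l/= scale0r.
have h : `|\sum_(N <= k < n) dot v (e k) *: d k| @[n --> \oo] -->
  `|K v - \sum_(k < N) dot v (e k) *: d k| by apply: cvg_norm; exact: tail_cvg.
apply: (@closed_cvg _ _ _ eventually_filter _ (fun x : R => x <= 1 / 2 * `|v|) _ _ _ h).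
  exact: closed_le.
near=> n.
have Nn : (N <= n)%N by near: n; exact: nbhs_infty_ge.
apply: (le_trans (ler_norm_sum _ _ _)).
under eq_bigr do rewrite normrZ.
apply: sum_mul_le => //; first by rewrite normr_gt0.
- apply: le_trans (bessel v n).
  under eq_bigr do rewrite real_normK ?num_real//.
  rewrite -[X in _ <= X](big_mkord xpredT (fun k => dot v (e k) ^+ 2)).
  rewrite [X in _ <= X](big_cat_nat (leq0n N) Nn)//= lerDr.
  by rewrite sumr_ge0// => k _; exact: sqr_ge0.
- have hn : (N2 <= n)%N by apply: leq_trans Nn; exact: leq_maxr.
  have /= /ltW := sub (N, n) (conj (hP N (leq_maxl _ _)) (hQ n hn)).
  by apply: le_trans; exact: ler_norm.
Unshelve. all: by end_near. Qed.

(* The perturbation is triangular on the span of the [e n] with [0 < n], so it is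
   undone one vector at a time, from the index where a Neumann series starts to
   converge down to [0]; each step is a rank one update whose determinant is
   [dot (e n + d n) (e n)]. *)
Lemma triangular_perturbation_invertible : d 0%N = 0 ->
  (forall m n, (0 < m < n)%N -> dot (d n) (e m) = 0) ->
  (forall n, (0 < n)%N -> 1 + dot (d n) (e n) != 0) ->
  exists2 A, bounded_invertible A & forall n, A (e n) = e n + d n.
Proof.
move=> d0 dtri ddiag.
exists (T 0).
  have [N] := T_invertible_large; elim: N => // N IH TN; apply: IH.
  have TE v : T N v = T N.+1 v + dot v (e N) *: d N.
    by rewrite /T big_ord_recr/= opprD !addrA subrK.
  (* At index 0 nothing is updated, since [d 0 = 0]; so the [d n] may have any component along
     [e 0]. *)
  have [N0|N0] := posnP N.
    suff -> : T N = T N.+1 by [].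
    by apply/funext => v; rewrite TE N0 d0 scaler0 addr0.
  rewrite (funext TE); apply: bounded_invertible_rank1 => //.
  - rewrite /T -[RHS]addr0; congr (_ + _).
    apply: (cvg_unique (@norm_hausdorff _ H) (@tail_cvg N.+1 (e N))).
    apply: cvg_near_cst; near=> n; rewrite big_nat big1// => k /andP[Nk _].
    by rewrite e_on ltn_eqF ?scale0r.
  - move=> u; rewrite /T linearDl/= -[RHS]addr0; congr (_ + _).
    have h := cvg_dot (e1 N) (@tail_cvg N.+1 u).
    apply: (cvg_unique (@norm_hausdorff _ R^o) h).
    apply: cvg_near_cst; near=> n; rewrite linear_sumlz/= big_nat big1// => k /andP[Nk _].
    by rewrite linearZl_LR/= dtri ?mulr0// N0.
  - exact: ddiag.
move=> n; rewrite /T big_ord0 subr0; congr (_ + _).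
rewrite /K; apply: cvg_lim; first exact: norm_hausdorff.
apply: cvg_near_cst; near=> m.
have nm : (n < m)%N by near: m; exact: nbhs_infty_gt.
rewrite /series/= (bigD1_seq n)/= ?mem_index_iota ?iota_uniq//.
rewrite e_on eqxx scale1r big1 ?addr0 => [//|i ni].
by rewrite e_on eq_sym (negbTE ni) scale0r.
Unshelve. all: by end_near. Qed.

End perturbation.

(** The factor [s] reconciles two normalisations: the eigenfunctions have supremum 1, the [e n] have
    unit norm. *)
Theorem riesz_basis_triangular_perturbation (f : nat -> H) (s : R) :
  (forall v, (forall n, dot v (e n) = 0) -> v = 0) ->
  s != 0 -> f 0%N = s *: e 0%N ->
  cvgn (series (fun n => `|s^-1 *: f n - e n| ^+ 2)) ->
  (forall m n, (0 < m < n)%N -> dot (f n) (e m) = 0) ->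
  (forall n, (0 < n)%N -> dot (f n) (e n) != 0) ->
  riesz_basis dot f.
Proof.
move=> tot s0 f0 fs ftri fdiag.
have [||||A Ai AE] := @triangular_perturbation_invertible (fun n => s^-1 *: f n - e n).
- exact: fs.
- by rewrite f0 scalerA mulVf// scale1r subrr.
- move=> m n mn; rewrite linearBl/= linearZl_LR/= ftri// e_on mulr0.
  by rewrite gtn_eqF ?subrr//; case/andP: mn.
- move=> n n0; rewrite linearBl/= linearZl_LR/= e_on eqxx addrC subrK.
  by rewrite mulf_neq0// ?invr_eq0//; exact: fdiag.
exists e, (fun v => s *: A v); split => //.
- exact: total_complete_system.
- exact/bounded_invertible_homeomorphism/bounded_invertible_scale.
- by move=> n; rewrite AE addrC subrK scalerA mulfV// scale1r.
Qed.

End orthonormal.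

End hilbert.

(** * Completeness of L2 *)

Section L2_complete.
Context d (T : measurableType d) (R : realType).
Variable mu : {measure set T -> \bar R}.
Local Notation L2mu := (L2 mu).
Implicit Types (u v : L2mu) (f g : T -> R).

Lemma Lfun2P f : measurable_fun setT f ->
  (\int[mu]_x ((f x) ^+ 2)%:E < +oo)%E -> f \in Lfun mu 2%:E.
Proof.
move=> mf foo; rewrite inE; apply/andP; split; rewrite inE//=.
rewrite /finite_norm unlock /Lnorm poweR_lty//.
move: foo; congr (_ < _)%E; apply: eq_integral => x _ /=.
by rewrite powR_mulrn// -normrX ger0_norm// sqr_ge0.
Qed.

Lemma L2_integral_sqr u : (\int[mu]_x ((u x) ^+ 2)%:E = (`|u| ^+ 2)%:E)%E.
Proof.
rewrite L2_normE /L2_dot /Rintegral fineK; first exact: eq_integral.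
have := integrable_fin_num measurableT (Lfun2_integrable_sqr (L2_Lfun u)).
by congr (_ \is a fin_num); apply: eq_integral.
Qed.

Lemma L2_of_integral_sqr f : f \in Lfun mu 2%:E ->
  ((`|L2_of mu f| ^+ 2)%:E = \int[mu]_x ((f x) ^+ 2)%:E)%E.
Proof.
move=> fL; rewrite -L2_integral_sqr.
apply: ge0_ae_eq_integral => //.
- by apply/measurable_EFinP; apply: measurable_funX; exact: L2_measurable.
- apply/measurable_EFinP; apply: measurable_funX.
  by move: fL; rewrite inE => /andP[]; rewrite inE.
- by move=> x _; rewrite lee_fin sqr_ge0.
- by move=> x _; rewrite lee_fin sqr_ge0.
- by apply: filterS (L2_ofE fL) => x /= h _; rewrite h.
Qed.

Lemma L2_BE u v : ((u - v : L2mu) : T -> R) = u \- v %[ae mu].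
Proof.
apply: filterS2 (L2_DE u (- v)) (L2_oppE v) => x h1 h2 _.
by rewrite h1//=; congr (_ + _); exact: h2.
Qed.

Lemma L2_sumE (u_ : nat -> L2mu) n :
  ((\sum_(k < n) u_ k : L2mu) : T -> R) = (fun x => \sum_(k < n) u_ k x) %[ae mu].
Proof.
elim: n => [|n IH].
  by rewrite big_ord0; apply: filterS (L2_0E mu) => x h _; rewrite h//= big_ord0.
rewrite big_ord_recr/=.
apply: filterS2 IH (L2_DE (\sum_(k < n) u_ k) (u_ n)) => x h1 h2 _.
by rewrite h2//= h1// big_ord_recr.
Qed.

Let ae_sqr f g : measurable_fun setT f -> measurable_fun setT g ->
  f = g %[ae mu] -> (\int[mu]_x ((f x) ^+ 2)%:E = \int[mu]_x ((g x) ^+ 2)%:E)%E.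
Proof.
move=> mf mg fg; apply: ge0_ae_eq_integral => //.
- by apply/measurable_EFinP; exact: measurable_funX.
- by apply/measurable_EFinP; exact: measurable_funX.
- by move=> x _; rewrite lee_fin sqr_ge0.
- by move=> x _; rewrite lee_fin sqr_ge0.
- by apply: filterS fg => x /= h _; rewrite h.
Qed.

(** * Riesz-Fischer: a series with summable norms converges in L2 *)

Section riesz_fischer.
Context (u_ : nat -> L2mu) (M : R).
Hypothesis u_le : forall n, \sum_(k < n) `|u_ k| <= M.

Let G n x := \sum_(k < n) `|u_ k x|.

Let mG n : measurable_fun setT (G n).
Proof.
apply: measurable_sum => k; apply: measurableT_comp => //.
exact: L2_measurable.
Qed.

Let normL k : (fun x => `|u_ k x|) \in Lfun mu 2%:E.
Proof.
apply: Lfun2P; first by apply: measurableT_comp => //; exact: L2_measurable.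
under eq_integral do rewrite real_normK ?num_real//.
by rewrite L2_integral_sqr ltry.
Qed.

(** Minkowski for the pointwise absolute values: their classes have the same norms as the [u_ k], so
    the triangle inequality of the L2 norm applies. *)
Let intG n : (\int[mu]_x ((G n x) ^+ 2)%:E <= (M ^+ 2)%:E)%E.
Proof.
pose a k := L2_of mu (fun x => `|u_ k x|).
have aE k : `|a k| = `|u_ k|.
  apply/eqP; rewrite -(@eqrXn2 _ 2)//; apply/eqP/EFin_inj.
  rewrite L2_of_integral_sqr// -L2_integral_sqr.
  by apply: eq_integral => x _; rewrite real_normK ?num_real//.
have aG : ((\sum_(k < n) a k : L2mu) : T -> R) = G n %[ae mu].
  have h : \forall x \ae mu, forall k, a k x = `|u_ k x|.
    apply/ae_foralln => k.
    by apply: filterS (L2_ofE (normL k)) => x h; exact: h.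
  apply: filterS2 (L2_sumE a n) h => x h1 h2 _; rewrite h1//.
  by apply: eq_bigr => k _; rewrite h2.
rewrite -(ae_sqr _ _ aG)//; last exact: L2_measurable.
rewrite L2_integral_sqr lee_fin ler_pXn2r ?nnegrE//; last first.
  by apply: le_trans (u_le 0); rewrite big_ord0.
apply: (le_trans (ler_norm_sum _ _ _)).
by under eq_bigr do rewrite aE.
Qed.

Let g x := limn (fun n => ((G n x) ^+ 2)%:E).

Let G_nd x : {homo (G ^~ x) : m n / (m <= n)%N >-> m <= n}.
Proof.
move=> m n mn; rewrite /G -!(big_mkord xpredT (fun k => `|u_ k x|)).
by rewrite (big_cat_nat (leq0n m) mn)/= lerDl sumr_ge0.
Qed.

Let G_ge0 n x : 0 <= G n x.
Proof. by rewrite sumr_ge0. Qed.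

Let G2_nd x : nondecreasing_seq (fun n => ((G n x) ^+ 2)%:E).
Proof.
move=> m n mn; rewrite lee_fin ler_pXn2r ?nnegrE//.
exact: G_nd.
Qed.

Let mG2 n : measurable_fun setT (fun x => ((G n x) ^+ 2)%:E).
Proof. by apply/measurable_EFinP; exact: measurable_funX. Qed.

Let mg : measurable_fun setT g.
Proof.
apply: (@emeasurable_fun_cvg _ _ _ _ (fun n x => ((G n x) ^+ 2)%:E)) => // x _.
exact: ereal_nondecreasing_is_cvgn.
Qed.

Let g_ge0 x : (0 <= g x)%E.
Proof.
apply: lime_ge; first exact: ereal_nondecreasing_is_cvgn.
by apply: nearW => n; rewrite lee_fin sqr_ge0.
Qed.

Let g_ae : \forall x \ae mu, (g x < +oo)%E.
Proof.
have ig : mu.-integrable setT g.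
  apply/integrableP; split => //.
  under eq_integral do rewrite gee0_abs//.
  rewrite /g monotone_convergence//; last first.
  - by move=> n x _; rewrite lee_fin sqr_ge0.
  apply: (@le_lt_trans _ _ (M ^+ 2)%:E); last exact: ltry.
  apply: lime_le; last by apply: nearW => n; exact: intG.
  apply: ereal_nondecreasing_is_cvgn => m n mn.
  apply: ge0_le_integral => //.
  - by move=> x _; rewrite lee_fin sqr_ge0.
  - by move=> x _; exact: G2_nd.
have := integrable_ae measurableT ig; apply: filterS => x /(_ I).
by rewrite ge0_fin_numE.
Qed.

Let S n x := \sum_(k < n) u_ k x.

Let S_cvg x : (g x < +oo)%E -> cvgn (S ^~ x).
Proof.
move=> gx.
have E : S ^~ x = series (fun k => u_ k x).
  by apply/funext => n; rewrite /series/= big_mkord.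
rewrite E; apply: normed_cvg; apply: nondecreasing_is_cvgn.
  by apply: nondecreasing_series => n _ _; exact: normr_ge0.
have gE : ((fine (g x))%:E = g x) by rewrite fineK// ge0_fin_numE.
(* From [t <= 1 + t^2], with [t] the partial sum of absolute values, whose square is at most
   [g x]. *)
exists (1 + fine (g x)) => _ [n _ <-].
rewrite (_ : [normed series _] n = G n x); last by rewrite /normed_series_of /series /= big_mkord.
have : ((G n x ^+ 2)%:E <= g x)%E.
  apply: lime_ge; first exact: ereal_nondecreasing_is_cvgn.
  by exists n => // m /= nm; exact: G2_nd.
rewrite -gE lee_fin => h.
have := sqr_ge0 (G n x - 1); have := G_ge0 n x; nra.
Qed.

Let D := [set x | (g x < +oo)%E].

Let mD : measurable D.
Proof.
rewrite /D -[X in measurable X]setTI.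
exact: emeasurable_fun_infty_o.
Qed.

(** Cutting off outside [D] makes the partial sums converge at every point, and not just almost
    everywhere, so that the limit is measurable. *)
Let s x := limn (fun n => \1_D x * S n x).

Let s_cvg x : (\1_D x * S n x) @[n --> \oo] --> s x.
Proof.
rewrite /s indicE; have [xD|xD] := boolP (x \in D).
  by apply: is_cvgMl_tmp; apply: S_cvg; rewrite inE in xD.
under eq_fun do rewrite mul0r.
exact: is_cvg_cst.
Qed.

Let mS n : measurable_fun setT (S n).
Proof. by apply: measurable_sum => k; exact: L2_measurable. Qed.

Let ms : measurable_fun setT s.
Proof.
apply: (@measurable_fun_cvg _ _ _ _ (fun n x => \1_D x * S n x)) => //.
by move=> n; apply: measurable_funM => //; exact: measurable_indic.
Qed.

Let s_ae : \forall x \ae mu, S n x @[n --> \oo] --> s x.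
Proof.
apply: filterS g_ae => x gx; have := @s_cvg x.
by rewrite indicE mem_set//; under eq_fun do rewrite mul1r.
Qed.

(** Fatou's lemma for fixed [n] and [m] tending to infinity: each integral of [(S m - S n)^2] is at
    most the square of a sum of norms over [n <= k < m]. *)
Let fatou_tail n (r : R) : 0 <= r ->
  (forall m, (n <= m)%N -> \sum_(n <= k < m) `|u_ k| <= r) ->
  (\int[mu]_x ((s x - S n x) ^+ 2)%:E <= (r ^+ 2)%:E)%E.
Proof.
move=> r0 ur.
pose S' m x : R := \1_D x * S m x.
have mS' m : measurable_fun setT (S' m).
  by apply: measurable_funM => //; exact: measurable_indic.
have S'E : \forall x \ae mu, forall m, S' m x = S m x.
  apply: filterS g_ae => x gx m; rewrite /S' indicE mem_set ?mul1r//.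
rewrite (@ae_sqr _ (fun x => s x - S' n x)); last 3 first.
- exact: measurable_funB.
- exact: measurable_funB.
- by apply: filterS S'E => x h _; rewrite h.
have -> : (\int[mu]_x ((s x - S' n x) ^+ 2)%:E =
   \int[mu]_x limn_einf (fun m => ((S' m x - S' n x) ^+ 2)%:E))%E.
  apply: eq_integral => x _; apply/esym.
  apply: (cvg_limn_einf_sup _).1; apply: cvg_EFin; first exact: nearW.
  apply: (@cvg_comp _ _ _ (fun m => S' m x - S' n x) (fun y => y ^+ 2)).
    by apply: cvgB; [exact: s_cvg|exact: cvg_cst].
  exact: exprn_continuous.
apply: le_trans.
  apply: fatou => //.
  - by move=> m; apply/measurable_EFinP; apply: measurable_funX; exact: measurable_funB.
  - by move=> m x _; rewrite lee_fin sqr_ge0.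
apply: (le_trans (limn_einf_sup _)); rewrite limn_esup_lim.
apply: lime_le; first exact: is_cvg_esups.
exists n => // m /= nm; apply: ge_ereal_sup => _ [p /= mp <-].
have np : (n <= p)%N by exact: leq_trans mp.
pose w : L2mu := \sum_(k < p) u_ k - \sum_(k < n) u_ k.
rewrite (@ae_sqr _ w); last 3 first.
- exact: measurable_funB.
- exact: L2_measurable.
- apply: filterS2 S'E (filterI (L2_sumE u_ p) (filterI (L2_sumE u_ n)
    (L2_BE (\sum_(k < p) u_ k) (\sum_(k < n) u_ k)))).
  move=> x h [h1 [h2 h3]] _; rewrite !h h3//=; congr (_ - _).
    by rewrite h1.
  by rewrite h2.
rewrite L2_integral_sqr lee_fin ler_pXn2r ?nnegrE//.
rewrite /w -!(big_mkord xpredT u_) (big_cat_nat (leq0n n) np)/= addrAC subrr add0r.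
by apply: (le_trans (ler_norm_sum _ _ _)); exact: ur.
Qed.

Lemma L2_series_cvg : cvgn (series u_).
Proof.
have cn : cvgn (series (fun k => `|u_ k|)).
  apply: nondecreasing_is_cvgn.
    by apply: nondecreasing_series => n _ _; exact: normr_ge0.
  by exists M => _ [n _ <-]; rewrite /series/= big_mkord.
have tail (e : R) : 0 < e -> exists N, forall n m, (N <= n)%N -> (n <= m)%N ->
    \sum_(n <= k < m) `|u_ k| <= e.
  move=> e0; move: cn => /cauchy_cvgP/cauchy_seriesP/(_ _ e0).
  move=> [[P Q] [/= [N1 _ hP] [N2 _ hQ]] sub].
  exists (maxn N1 N2) => n m; rewrite geq_max => /andP[n1 n2] nm.
  have := sub (n, m) (conj (hP n n1) (hQ m (leq_trans n2 nm))).
  by move=> /= /ltW; apply: le_trans; exact: ler_norm.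
have tail_int e : 0 < e -> exists N, forall n, (N <= n)%N ->
    (\int[mu]_x ((s x - S n x) ^+ 2)%:E <= (e ^+ 2)%:E)%E.
  move=> e0; have [N hN] := tail e e0; exists N => n Nn.
  by apply: fatou_tail; [exact: ltW|move=> m; exact: hN].
have SE n : S n = (series u_ n : L2mu) %[ae mu].
  apply: filterS (L2_sumE u_ n) => x h _.
  by rewrite /series/= big_mkord h.
(* Square integrability of the limit is inherited from one partial sum at finite L2 distance from
   it; distance 1 is an arbitrary choice. *)
have sL : s \in Lfun mu 2%:E.
  have [N hN] := tail_int 1 ltr01.
  have dL : (fun x => s x - S N x) \in Lfun mu 2%:E.
    apply: Lfun2P; first exact: measurable_funB.
    by apply: (le_lt_trans (hN N (leqnn N))); exact: ltry.
  have SL : S N \in Lfun mu 2%:E.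
    apply: Lfun2P => //; rewrite (ae_sqr _ _ (SE N))//; last exact: L2_measurable.
    by rewrite L2_integral_sqr ltry.
  rewrite (_ : s = (fun x => s x - S N x) \+ S N).
    by apply: (Lfun_addr_closed mu (lee1n 2)).2.
  by apply/funext => x /=; rewrite subrK.
apply/cvg_ex; exists (L2_of mu s); apply/cvgrPdist_le => e e0.
have [N hN] := tail_int e e0; exists N => // n /= Nn.
rewrite -(@ler_pXn2r _ 2) ?nnegrE//; last exact: ltW.
rewrite -lee_fin -L2_integral_sqr; apply: le_trans (hN n Nn).
rewrite le_eqVlt; apply/orP; left; apply/eqP; apply: ae_sqr.
- exact: L2_measurable.
- exact: measurable_funB.
- apply: filterS2 (L2_BE (L2_of mu s) (series u_ n)) (filterI (L2_ofE sL) (SE n)).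
  by move=> x h [h1 h2] _; rewrite h//= h1// h2.
Qed.

End riesz_fischer.

Lemma L2_cauchy_cvg (F : set_system L2mu) : ProperFilter F -> cauchy F -> cvg F.
Proof.
move=> FF /cauchyP cF.
(* Centres of balls of radius [(1 / 2) ^+ n] belonging to the filter turn it into a sequence with
   summable increments, whose telescoping series converges. *)
have /choice[x hx] : forall n, exists x : L2mu, F (ball x ((1 / 2) ^+ n)).
  by move=> n; apply: cF; rewrite exprn_gt0.
have dx n : `|x n.+1 - x n| <= 2 * (1 / 2) ^+ n.
  have hF : Filter F by exact: filter_filter.
  have /filter_ex[y [y1 y2]] := @filterI _ F hF _ _ (hx n) (hx n.+1).
  move: y1 y2; rewrite -!ball_normE /= => y1 y2.
  rewrite -(subrK y (x n.+1)) -addrA.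
  apply: (le_trans (ler_normD _ _)); rewrite [`|y - _|]distrC.
  apply: (le_trans (lerD (ltW y2) (ltW y1))).
  by have := exprn_gt0 n (_ : 0 < 1 / 2 :> R); rewrite exprS; lra.
(* 4 is the sum of the geometric bounds [2 * (1 / 2) ^+ k]; keeping the remainder [4 * (1 / 2) ^+ n]
   lets the induction close. *)
have dsum n : \sum_(k < n) `|x k.+1 - x k| <= 4.
  apply: (@le_trans _ _ (4 - 4 * (1 / 2) ^+ n)).
    elim: n => [|n IH]; first by rewrite big_ord0 expr0; lra.
    by rewrite big_ord_recr/= exprS; have := dx n; lra.
  by rewrite lerBlDr lerDl mulr_ge0// exprn_ge0.
have /cvg_ex[/= y xy] := @L2_series_cvg (fun n => x n.+1 - x n) 4 dsum.
have xl : x n @[n --> \oo] --> y + x 0%N.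
  have h : (series (fun n => x n.+1 - x n) n + x 0%N) @[n --> \oo] --> y + x 0%N.
    by apply: cvgD; [exact: xy|exact: cvg_cst].
  suff E : (fun n => series (fun n => x n.+1 - x n) n + x 0%N) = x by rewrite E in h.
  by apply/funext => n; rewrite /series/= telescope_sumr// subrK.
apply/cvg_ex; exists (y + x 0%N); apply/cvgrPdist_lt => e e0.
have e2 : 0 < e / 2 by rewrite divr_gt0.
have [n [hn1 hn2]] : exists n, `|y + x 0%N - x n| < e / 2 /\ (1 / 2) ^+ n < e / 2.
  have h1 : \forall n \near \oo, `|y + x 0%N - x n| < e / 2.
    exact: (cvgr_dist_lt _ _ xl _ e2).
  have h2 : \forall n \near \oo, (1 / 2 : R) ^+ n < e / 2.
    have h0 : `|1 / 2 : R| < 1 by rewrite ger0_norm//; lra.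
    apply: filterS (cvgr_dist_lt _ _ (@cvg_geometric R 1 _ h0) _ e2) => n.
    by rewrite /= sub0r normrN (mul1r (_ ^+ n)); apply: le_lt_trans; exact: ler_norm.
  by have [n [? ?]] := filter_ex (filterI h1 h2); exists n.
have := hx n; apply: filterS => z; rewrite -ball_normE /= => xz.
rewrite -(subrK (x n) (y + x 0%N)) -addrA.
apply: (le_lt_trans (ler_normD _ _)); rewrite [e]splitr.
by apply: ltrD => //; exact: lt_trans hn2.
Unshelve. all: by end_near. Qed.

HB.instance Definition _ := Uniform_isComplete.Build L2mu L2_cauchy_cvg.

End L2_complete.

(** * The cosine system in L2(0, pi) *)

Section L2_0pi_theory.
Context (R : realType).
Local Notation mu0 := (lebesgue_0pi R).
Local Notation mu := (@lebesgue_measure R).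
Local Notation I := (`]0, (pi : R)[%classic : set R).
Implicit Types (g h : R -> R) (v : L2_0pi R).

Lemma ae_0pi : \forall x \ae mu0, 0 < x < pi.
Proof.
exists (~` I); split.
- by apply: measurableC; exact: measurable_itv.
- by rewrite /= /mrestr setICl measure0.
- by move=> x xI; rewrite /= in_itv.
Qed.

Global Instance ae_0pi_filter : Filter (almost_everywhere mu0).
Proof. exact: (ae_filter_ringOfSetsType (T := measurableTypeR R)). Qed.

Lemma Lfun_0pi_bounded h M : measurable_fun setT h ->
  (forall x, 0 < x < pi -> `|h x| <= M) -> h \in Lfun mu0 2%:E.
Proof.
move=> mh hM; apply: Lfun2P => //.
apply: (@le_lt_trans _ _ (\int[mu0]_x (M ^+ 2)%:E)%E).
  apply: ae_ge0_le_integral => //.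
  - by move=> x _; rewrite lee_fin sqr_ge0.
  - by apply/measurable_EFinP; exact: measurable_funX.
  - by move=> x _; rewrite lee_fin sqr_ge0.
  - apply: filterS ae_0pi => x xI _; rewrite lee_fin -real_normK ?num_real//.
    by rewrite ler_pXn2r ?nnegrE//; [exact: hM|apply: le_trans (hM x xI)].
rewrite integral_cst//= /mrestr setTI lebesgue_measure_itv/= lte_fin pi_gt0.
by rewrite -EFinD -EFinM ltry.
Qed.

Lemma Lfun_0pi_continuous h : continuous h -> h \in Lfun mu0 2%:E.
Proof.
move=> ch.
have [c _ hc] : exists2 c, c \in `[0, pi : R]%R &
    forall t, t \in `[0, pi : R]%R -> `|h t| <= `|h c|.
  apply: (@EVT_max _ (fun x => `|h x|)); first exact: pi_ge0.
  by apply: continuous_subspaceT => x; apply: continuous_comp; [exact: ch|exact: norm_continuous].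
apply: (@Lfun_0pi_bounded _ `|h c|); first exact: continuous_measurable_fun.
by move=> x /andP[x0 xp]; apply: hc; rewrite in_itv/= !ltW.
Qed.

Lemma L2_0pi_ofE h : h \in Lfun mu0 2%:E -> (L2_0pi_of h : R -> R) = h %[ae mu0].
Proof.
move=> hL.
have hp : h \_ I = h %[ae mu0].
  by apply: filterS ae_0pi => x xI _; rewrite patchE mem_set//= in_itv.
have pL : h \_ I \in Lfun mu0 2%:E.
  have mh : measurable_fun setT h.
    by move: hL; rewrite inE => /andP[]; rewrite inE.
  have mp : measurable_fun setT (h \_ I).
    by apply/(measurable_restrictT _ _).1 => //; exact: measurable_funTS.
  apply: Lfun2P => //.
  rewrite (_ : (\int[mu0]_x _)%E = (\int[mu0]_x ((h x) ^+ 2)%:E)%E).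
    by rewrite -L2_of_integral_sqr// ltry.
  apply: ge0_ae_eq_integral => //.
  - by apply/measurable_EFinP; exact: measurable_funX.
  - by apply/measurable_EFinP; exact: measurable_funX.
  - by move=> x _; rewrite lee_fin sqr_ge0.
  - by move=> x _; rewrite lee_fin sqr_ge0.
  - by apply: filterS hp => x h1 _; rewrite h1.
apply: filterS2 hp (L2_ofE pL) => x h1 h2 _.
by rewrite -h1//; exact: h2.
Qed.

(** This permits replacing an eigenfunction, known only on [[0, pi]], by a function continuous on
    the whole line. *)
Lemma eq_L2_0pi_of g h : (forall x, 0 < x < pi -> g x = h x) ->
  L2_0pi_of g = L2_0pi_of h.
Proof.
move=> gh; rewrite /L2_0pi_of; congr (L2_of _ _); apply/funext => x; rewrite /patch.
by case: ifPn => //; rewrite inE/= in_itv/=; exact: gh.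
Qed.

Lemma L2_0pi_norm_le (w : L2_0pi R) (M : R) :
  (\forall x \ae mu0, `|w x| <= M) -> `|w| ^+ 2 <= M ^+ 2 * pi.
Proof.
move=> wM; rewrite -lee_fin -L2_integral_sqr.
apply: (@le_trans _ _ (\int[mu0]_x (M ^+ 2)%:E)%E).
  apply: ae_ge0_le_integral => //.
  - by move=> x _; rewrite lee_fin sqr_ge0.
  - by apply/measurable_EFinP; apply: measurable_funX; exact: L2_measurable.
  - by move=> x _; rewrite lee_fin sqr_ge0.
  - apply: filterS wM => x xM _; rewrite lee_fin -real_normK ?num_real//.
    by rewrite ler_pXn2r ?nnegrE//; apply: le_trans xM.
rewrite integral_cst//= /mrestr setTI lebesgue_measure_itv/= lte_fin pi_gt0.
by rewrite -EFinD -EFinM subr0.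
Qed.

Lemma Rintegral_0pi h : h \in Lfun mu0 1 ->
  \int[mu0]_x h x = \int[mu]_(x in I) h x.
Proof.
move=> /Lfun1_integrable hi.
have mI : measurable (I : set (measurableTypeR R)) by exact: measurable_itv.
congr fine; rewrite (@negligible_integral _ (measurableTypeR R) _ mu0 setT (~` I))//.
- rewrite setTD setCK; apply: eq_measure_integral => A mA AD.
  by rewrite /= /mrestr setIidl.
- exact: measurableC.
- by rewrite /= /mrestr setICl measure0.
Qed.

Lemma L2_dot_of v h : h \in Lfun mu0 2%:E ->
  L2_dot v (L2_0pi_of h) = \int[mu0]_x (v x * h x).
Proof.
move=> hL; congr fine; apply: ae_eq_integral => //.
- by apply/measurable_EFinP; apply: measurable_funM; exact: L2_measurable.
- apply/measurable_EFinP; apply: measurable_funM; first exact: L2_measurable.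
  by move: hL; rewrite inE => /andP[]; rewrite inE.
- by apply: filterS (L2_0pi_ofE hL) => x h1 _; congr (_ * _)%:E; exact: h1.
Qed.

Lemma L2_dot_of_continuous g h : continuous g -> continuous h ->
  L2_dot (L2_0pi_of g) (L2_0pi_of h) = \int[mu]_(x in I) (g x * h x).
Proof.
move=> cg ch; have gL := Lfun_0pi_continuous cg; have hL := Lfun_0pi_continuous ch.
rewrite L2_dot_of// -Rintegral_0pi; last exact: Lfun2_mul_Lfun1.
congr fine; apply: ae_eq_integral => //.
- apply/measurable_EFinP; apply: measurable_funM; first exact: L2_measurable.
  exact: continuous_measurable_fun.
- by apply/measurable_EFinP; apply: measurable_funM; exact: continuous_measurable_fun.
- by apply: filterS (L2_0pi_ofE gL) => x h1 _; congr (_ * _)%:E; exact: h1.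
Qed.

Lemma Rintegral_FTC (F h : R -> R) : continuous h ->
  (forall x : R, 0 <= x <= pi -> is_derive x 1 F (h x)) ->
  \int[mu]_(x in I) h x = F pi - F 0.
Proof.
move=> ch dF.
have mh : measurable_fun setT (EFin \o h).
  by apply/measurable_EFinP; exact: continuous_measurable_fun.
rewrite /Rintegral integral_itv_obnd_cbnd; last exact: measurable_funTS.
rewrite integral_itv_bndo_bndc; last exact: measurable_funTS.
have cF (x : R) : 0 <= x <= pi -> {for x, continuous F}.
  move=> /dF dFx; apply/differentiable_continuous/derivable1_diffP.
  exact: ex_derive.
have c0 : {for 0, continuous F} by apply: cF; rewrite lexx pi_ge0.
have cpi : {for pi, continuous F} by apply: cF; rewrite lexx pi_ge0.
have oo_cc (x : R) : x \in `]0, pi[ -> 0 <= x <= pi.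
  by rewrite in_itv/= => /andP[x0 xp]; rewrite !ltW.
rewrite (continuous_FTC2 (pi_gt0 R) (F := F))//.
- exact: continuous_subspaceT.
- split.
  + by move=> x /oo_cc/dF ?; exact: ex_derive.
  + exact: cvg_at_right_filter.
  + exact: cvg_at_left_filter.
- by move=> x /oo_cc/dF ?; rewrite derive1E; exact: derive_val.
Qed.

End L2_0pi_theory.

Section trigonometric_derivatives.
Context (R : realType).
Implicit Types (k c x : R).

Lemma is_derive_affine (k c x : R) : is_derive x 1 (fun y : R => k * y + c) k.
Proof.
by apply: is_derive_eq; rewrite ?addr0 /GRing.scale/= ?mulr1 ?mulr0 ?addr0 ?add0r.
Qed.

Lemma is_derive_comp_affine (f : R -> R) (k c x df : R) :
  is_derive (k * x + c) 1 f df -> is_derive x 1 (fun y => f (k * y + c)) (k * df).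
Proof.
move=> hf; rewrite mulrC.
exact: (@is_derive1_comp _ f (fun y => k * y + c) x df k hf (is_derive_affine k c x)).
Qed.

Lemma is_derive_cosM k x : is_derive x 1 (fun y => cos (k * y)) (- (k * sin (k * x))).
Proof.
have := @is_derive_comp_affine cos k 0 x _ (is_derive_cos _).
rewrite addr0 mulrN; congr (is_derive _ _ _ _).
by apply/funext => y; rewrite addr0.
Qed.

Lemma is_derive_sinM k x : is_derive x 1 (fun y => sin (k * y)) (k * cos (k * x)).
Proof.
have := @is_derive_comp_affine sin k 0 x _ (is_derive_sin _).
rewrite addr0; congr (is_derive _ _ _ _).
by apply/funext => y; rewrite addr0.
Qed.

Lemma sin_natpi n : sin (n%:R * pi) = 0 :> R.
Proof.
elim: n => [|n IH]; first by rewrite mul0r sin0.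
by rewrite -natr1 mulrDl mul1r sinDpi IH oppr0.
Qed.

Lemma continuous_cosM k : continuous (fun x => cos (k * x)).
Proof.
move=> x; apply/differentiable_continuous/derivable1_diffP.
by apply: ex_derive; exact: is_derive_cosM.
Qed.

End trigonometric_derivatives.

Section cos_system.
Context (R : realType).
Local Notation mu0 := (lebesgue_0pi R).
Local Notation mu := (@lebesgue_measure R).
Local Notation I := (`]0, (pi : R)[%classic : set R).

Lemma Rintegral_cos_cos_neq (n m : nat) : n != m ->
  \int[mu]_(x in I) (cos (n%:R * x) * cos (m%:R * x)) = 0.
Proof.
move=> nm.
have s0 : n%:R + m%:R != 0 :> R by rewrite -natrD pnatr_eq0; case: n m nm => [|n] [|m].
have d0 : n%:R - m%:R != 0 :> R by rewrite subr_eq0 eqr_nat.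
pose F x : R := (2 * (n%:R + m%:R))^-1 * sin ((n%:R + m%:R) * x)
  + (2 * (n%:R - m%:R))^-1 * sin ((n%:R - m%:R) * x).
transitivity (F pi - F 0); last first.
  rewrite /F !mulr0 sin0 !mulr0.
  rewrite (mulrDl n%:R m%:R) (mulrBl pi n%:R m%:R) sinD sinB !sin_natpi.
  by rewrite !(mul0r, mulr0, addr0, subr0).
apply: (@Rintegral_FTC _ F).
- by move=> x; apply: cvgM; exact: continuous_cosM.
- move=> x _.
  have h := is_deriveD (is_deriveZ (2 * (n%:R + m%:R))^-1 (is_derive_sinM (n%:R + m%:R) x))
    (is_deriveZ (2 * (n%:R - m%:R))^-1 (is_derive_sinM (n%:R - m%:R) x)).
  refine (is_derive_eq h _).
  rewrite /GRing.scale/= (mulrDl n%:R m%:R x) (mulrBl x n%:R m%:R) cosD cosB.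
  by field; rewrite s0 d0.
Qed.

Lemma Rintegral_cos_sqr (n : nat) :
  \int[mu]_(x in I) (cos (n%:R * x) * cos (n%:R * x)) = if n == 0%N then pi else pi / 2.
Proof.
case: n => [|n] /=.
  transitivity (id (pi : R) - id 0); last by rewrite subr0.
  apply: (@Rintegral_FTC _ id).
  - by move=> x; apply: cvgM; exact: continuous_cosM.
  - by move=> x _; rewrite mul0r cos0 mulr1; exact: is_derive_id.
set k : R := n.+1%:R.
have k0 : k != 0 by rewrite pnatr_eq0.
pose F x : R := 2^-1 * x + (2 * k)^-1 * (sin (k * x) * cos (k * x)).
transitivity (F pi - F 0); last first.
  by rewrite /F !mulr0 sin0 sin_natpi !mul0r !mulr0 !addr0 subr0 mulrC.
apply: (@Rintegral_FTC _ F).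
- by move=> x; apply: cvgM; exact: continuous_cosM.
- move=> x _.
  have h := is_deriveD (is_deriveZ (2^-1 : R) (is_derive_id x (1 : R)))
    (is_deriveZ (2 * k)^-1 (is_deriveM (is_derive_sinM k x) (is_derive_cosM k x))).
  refine (is_derive_eq h _).
  rewrite /GRing.scale/=.
  have := cos2Dsin2 (k * x); set c := cos _; set s := sin _ => cs.
  rewrite [X in _ + X](_ : _ = 2^-1 * (c * c - s * s)); last by field.
  have -> : s * s = 1 - c * c by lra.
  by rewrite mulr1; field.
Qed.

Lemma continuous_integrable_0pi (h : R -> R) : continuous h -> mu.-integrable I (EFin \o h).
Proof.
move=> ch; apply: (@integrableS _ _ R mu `[0, (pi : R)]%classic) => //=.
  exact: subset_itv_oo_cc.
apply: continuous_compact_integrable; first exact: segment_compact.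
exact: continuous_subspaceT.
Qed.

(** The value at 0 is [1 / sqrt pi], all others are [sqrt (2 / pi)]; hence [(cos_coef 1)^-1] is the
    factor [s]. *)
Definition cos_coef (n : nat) : R := Num.sqrt ((if n == 0%N then 1 else 2) / pi).

Definition cos_basis (n : nat) : L2_0pi R :=
  L2_0pi_of (fun x => cos_coef n * cos (n%:R * x)).

Lemma cos_coef_gt0 n : 0 < cos_coef n.
Proof. by rewrite sqrtr_gt0 divr_gt0 ?pi_gt0//; case: ifP. Qed.

Lemma continuous_cos_basis n : continuous (fun x : R => cos_coef n * cos (n%:R * x)).
Proof. by move=> x; apply: cvgMr; exact: continuous_cosM. Qed.

Lemma L2_dot_cos_basis (v : L2_0pi R) n :
  L2_dot v (cos_basis n) = cos_coef n * \int[mu0]_x (v x * cos (n%:R * x)).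
Proof.
rewrite L2_dot_of; last exact/Lfun_0pi_continuous/continuous_cos_basis.
rewrite -RintegralZl//.
  by apply: eq_Rintegral => x _; ring.
apply/Lfun1_integrable/Lfun2_mul_Lfun1; first exact: L2_Lfun.
by apply: Lfun_0pi_continuous; exact: continuous_cosM.
Qed.

Lemma cos_basis_orthonormal :
  orthonormal_system (@L2_dot _ _ R mu0) cos_basis.
Proof.
move=> i j.
transitivity (\int[mu]_(x in I) (cos_coef i * cos (i%:R * x) * (cos_coef j * cos (j%:R * x)))).
  by apply: L2_dot_of_continuous; exact: continuous_cos_basis.
transitivity (\int[mu]_(x in I) (cos_coef i * cos_coef j * (cos (i%:R * x) * cos (j%:R * x)))).
  by apply: eq_Rintegral => x _; ring.
rewrite RintegralZl//=; last first.
  apply: continuous_integrable_0pi.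
  by move=> x; apply: cvgM; exact: continuous_cosM.
have [<-|ij] := eqVneq i j; last by rewrite Rintegral_cos_cos_neq// mulr0.
rewrite Rintegral_cos_sqr -expr2 sqr_sqrtr; last by rewrite divr_ge0 ?pi_ge0//; case: ifP.
have p0 : (pi : R) != 0 by rewrite gt_eqF ?pi_gt0.
case: (i == 0%N); rewrite ?eqxx /=; first by rewrite divfK.
by rewrite mulrA divfK// mulfV// pnatr_eq0.
Qed.

Lemma L2_dot_of_cos_basis (g : R -> R) m : continuous g ->
  L2_dot (L2_0pi_of g) (cos_basis m) = cos_coef m * \int[mu]_(x in I) (g x * cos (m%:R * x)).
Proof.
move=> cg; rewrite L2_dot_of_continuous//; last exact: continuous_cos_basis.
rewrite -RintegralZl//; first by apply: eq_Rintegral => x _; ring.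
by apply: continuous_integrable_0pi => x; apply: cvgM; [exact: cg|exact: continuous_cosM].
Qed.

Lemma L2_0pi_of_cst_cos_basis :
  L2_0pi_of (fun=> Num.sqrt 2 / 2) = (cos_coef 1)^-1 *: cos_basis 0.
Proof.
have c0 n : 0 <= cos_coef n := ltW (cos_coef_gt0 n).
have cc : (cos_coef 1)^-1 * cos_coef 0 = Num.sqrt 2 / 2.
  rewrite -[LHS]ger0_norm; last by rewrite mulr_ge0 ?invr_ge0.
  rewrite -[RHS]ger0_norm ?divr_ge0 ?sqrtr_ge0// -!sqrtr_sqr; congr Num.sqrt.
  have pi0 := pi_gt0 R.
  rewrite !exprMn !exprVn !sqr_sqrtr//= ?divr_ge0 ?(ltW pi0)//.
  by move: (pi : R) pi0 => p p0; field; rewrite gt_eqF.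
apply/L2P; apply: filterS3 (L2_ZE (cos_coef 1)^-1 (cos_basis 0))
  (L2_0pi_ofE (Lfun_0pi_continuous (@continuous_cos_basis 0)))
  (L2_0pi_ofE (Lfun_0pi_continuous (@cst_continuous _ _ (Num.sqrt 2 / 2 : R)))).
move=> x h1 h2 h3 _; refine (etrans (h3 Logic.I) (esym (etrans (h1 Logic.I) _))).
transitivity ((cos_coef 1)^-1 * (cos_coef 0 * cos (0 * x))).
  by congr (_ * _); exact: h2.
by rewrite mul0r cos0 mulr1.
Qed.

Lemma norm_L2_0pi_of_sub_cos_basis (g : R -> R) n (M : R) : (0 < n)%N -> continuous g ->
  (forall x, `|g x - cos (n%:R * x)| <= M) ->
  `|cos_coef 1 *: L2_0pi_of g - cos_basis n| ^+ 2 <= (cos_coef 1 * M) ^+ 2 * pi.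
Proof.
move=> n0 cg gM; apply: L2_0pi_norm_le.
apply: filterS3 (L2_BE (cos_coef 1 *: L2_0pi_of g) (cos_basis n))
  (L2_ZE (cos_coef 1) (L2_0pi_of g))
  (filterI (L2_0pi_ofE (Lfun_0pi_continuous cg))
     (L2_0pi_ofE (Lfun_0pi_continuous (@continuous_cos_basis n)))) => x h1 h2 [h3 h4].
have E : (cos_coef 1 *: L2_0pi_of g - cos_basis n : L2_0pi R) x
    = cos_coef 1 * (g x - cos (n%:R * x)).
  refine (etrans (h1 Logic.I) _); rewrite mulrBr; congr (_ - _).
    by refine (etrans (h2 Logic.I) _); congr (_ * _); exact: h3.
  by refine (etrans (h4 Logic.I) _); rewrite /cos_coef (gtn_eqF n0).
rewrite [X in `|X|]E normrM gtr0_norm ?cos_coef_gt0// ler_pM2l ?cos_coef_gt0//.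
Qed.

(** Induction on the polynomial with all frequencies at once: multiplying [cos (n x)] by [cos x]
    gives the mean of the cosines of frequencies [n + 1] and [n - 1]. For [n = 0] it is just
    [cos x]. *)
Lemma Rintegral_cos_horner (v : L2_0pi R) :
  (forall n, L2_dot v (cos_basis n) = 0) ->
  forall (p : {poly R}) n, \int[mu0]_x (v x * (p.[cos x] * cos (n%:R * x))) = 0.
Proof.
move=> v0.
have base n : \int[mu0]_x (v x * cos (n%:R * x)) = 0.
  have /eqP := v0 n; rewrite L2_dot_cos_basis mulf_eq0 gt_eqF ?cos_coef_gt0//=.
  by move/eqP.
have cont (p : {poly R}) n : continuous (fun x => p.[cos x] * cos (n%:R * x)).
  move=> x; apply: cvgM; last exact: continuous_cosM.
  exact: (@continuous_comp _ _ _ cos (horner p)  x (@continuous_cos _ x) (@continuous_horner _ p _)).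
have int (h : R -> R) : continuous h -> mu0.-integrable setT (EFin \o (fun x => v x * h x)).
  move=> ch; apply/Lfun1_integrable/Lfun2_mul_Lfun1; first exact: L2_Lfun.
  exact: Lfun_0pi_continuous.
have intZ (k : R) (h : R -> R) : continuous h ->
    mu0.-integrable setT (EFin \o (fun x => k * (v x * h x))).
  move=> ch; have := integrableZl measurableT k (int h ch); exact: eq_integrable.
elim/poly_ind => [|p c IH] n.
  transitivity (\int[mu0]_x (0 * (v x * cos (n%:R * x)))).
    by apply: eq_Rintegral => x _; rewrite horner0; ring.
  by rewrite RintegralZl ?mul0r//; apply: int; exact: continuous_cosM.
have step (q : {poly R}) : (forall n, \int[mu0]_x (v x * (q.[cos x] * cos (n%:R * x))) = 0) ->
   \int[mu0]_x (v x * (q.[cos x] * (cos x * cos (n%:R * x)))) = 0.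
  case: n => [|n] hq.
    rewrite -[RHS](hq 1%N); apply: eq_Rintegral => x _.
    by rewrite mul0r cos0 mulr1 mul1r.
  transitivity (\int[mu0]_x (2^-1 * (v x * (q.[cos x] * cos (n.+2%:R * x))) +
      2^-1 * (v x * (q.[cos x] * cos (n%:R * x))))); last first.
    rewrite RintegralD//; try (apply: intZ; exact: cont).
    by rewrite !RintegralZl//; try (apply: int; exact: cont); rewrite !hq mulr0 addr0.
  apply: eq_Rintegral => x _.
  have -> : n.+2%:R * x = n.+1%:R * x + x by rewrite -[n.+2%:R]natr1; ring.
  have -> : n%:R * x = n.+1%:R * x - x by rewrite -[n.+1%:R]natr1; ring.
  by rewrite cosD cosB; field.
transitivity (\int[mu0]_x (v x * (p.[cos x] * (cos x * cos (n%:R * x))) + c * (v x * cos (n%:R * x)))).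
  by apply: eq_Rintegral => x _; rewrite hornerMXaddC; ring.
rewrite RintegralD//.
- rewrite step// add0r RintegralZl//; last by apply: int; exact: continuous_cosM.
  by rewrite base mulr0.
- apply: int => x; apply: cvgM; last by apply: cvgM; [exact: continuous_cos|exact: continuous_cosM].
  exact: (@continuous_comp _ _ _ cos (horner p) x (@continuous_cos _ x) (@continuous_horner _ p _)).
- by apply: intZ; exact: continuous_cosM.
Qed.

End cos_system.

(** * Polynomials converging to a step function on [0, 1] *)

Section step_approximation.
Context (R : realType).
Implicit Types (t x : R).

Lemma bernoulli_sub t n : 0 <= t <= 1 -> 1 - n%:R * t <= (1 - t) ^+ n.
Proof.
move=> /andP[t0 t1]; elim: n => [|n IH]; first by rewrite expr0; lra.
rewrite exprS; have := ler_wpM2l (_ : 0 <= 1 - t) IH; rewrite subr_ge0 => /(_ t1).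
apply: le_trans; rewrite -natr1.
have : 0 <= n%:R * t * t by rewrite !mulr_ge0.
lra.
Qed.

(** The upper bound [(1 - t)^n <= 1 / (1 + n t)], which follows by induction from
    [(1 - t) (1 + (n + 1) t) <= 1 + n t]. *)
Lemma bernoulli_mul t n : 0 <= t <= 1 -> (1 - t) ^+ n * (1 + n%:R * t) <= 1.
Proof.
move=> /andP[t0 t1]; elim: n => [|n IH]; first by rewrite expr0; lra.
apply: le_trans IH; rewrite exprSr -mulrA ler_wpM2l ?exprn_ge0 ?subr_ge0// -natr1.
have : 0 <= n%:R * t * t by rewrite !mulr_ge0.
have : 0 <= t * t by rewrite mulr_ge0.
lra.
Qed.

(* The polynomials [(1 - t^j)^(2^j)] of the Brosowski-Deutsch proof of the
   Stone-Weierstrass theorem. *)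
Definition step_poly (j : nat) : {poly R} := (1 - 'X^j) ^+ (2 ^ j).

Lemma step_polyE j t : (step_poly j).[t] = (1 - t ^+ j) ^+ (2 ^ j).
Proof. by rewrite /step_poly horner_exp !hornerE. Qed.

Lemma step_poly_bounds j t : 0 <= t <= 1 -> 0 <= (step_poly j).[t] <= 1.
Proof.
move=> /andP[t0 t1]; rewrite step_polyE.
have h1 : 0 <= t ^+ j by rewrite exprn_ge0.
have h2 : t ^+ j <= 1 by rewrite exprn_ile1.
by rewrite exprn_ge0 ?subr_ge0//= exprn_ile1 ?subr_ge0// lerBlDr lerDl.
Qed.

(** Bernoulli bounds the value below by [1 - 2^j t^j = 1 - (2 t)^j], so the jump sits where [2 t]
    crosses 1. *)
Lemma step_poly_cvg1 t : 0 <= t < 1 / 2 -> (step_poly j).[t] @[j --> \oo] --> (1 : R).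
Proof.
move=> /andP[t0 t2]; have t1 : t <= 1 by lra.
have t01 : 0 <= t <= 1 by rewrite t0.
apply: (@squeeze_cvgr _ _ _ _ (fun j => 1 - (2 * t) ^+ j) (fun=> 1)).
- apply: nearW => j; have /andP[_ ->] := step_poly_bounds j t01.
  rewrite andbT step_polyE exprMn -natrX; apply: bernoulli_sub.
  by rewrite exprn_ge0// exprn_ile1.
- rewrite -[X in _ --> X]subr0; apply: cvgB; first exact: cvg_cst.
  by apply: cvg_expr; rewrite ger0_norm ?mulr_ge0//; lra.
- exact: cvg_cst.
Qed.

(** Here [bernoulli_mul] bounds the value above by [1 / (1 + (2 t)^j)], hence by [(2 t)^-j]. *)
Lemma step_poly_cvg0 t : 1 / 2 < t <= 1 -> (step_poly j).[t] @[j --> \oo] --> (0 : R).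
Proof.
move=> /andP[t2 t1]; have t0 : 0 <= t by lra.
have t0' : 0 < 2 * t by lra.
have t01 : 0 <= t <= 1 by rewrite t0.
apply: (@squeeze_cvgr _ _ _ _ (fun=> 0) (fun j => ((2 * t)^-1) ^+ j)).
- apply: nearW => j; have /andP[-> _] := step_poly_bounds j t01.
  rewrite /= step_polyE exprVn -div1r ler_pdivlMr ?exprn_gt0//.
  have h : 0 <= t ^+ j <= 1 by rewrite exprn_ge0// exprn_ile1.
  apply: le_trans (bernoulli_mul (2 ^ j) h).
  rewrite natrX -exprMn ler_wpM2l ?lerDr//.
  by rewrite exprn_ge0// subr_ge0; case/andP: h.
- exact: cvg_cst.
- apply: cvg_expr; rewrite ger0_norm ?invr_ge0 ?ltW//.
  by rewrite invf_lt1//; lra.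
Qed.

End step_approximation.

(** * Only zero is orthogonal to all cosines *)

Section cos_total.
Context (R : realType).
Local Notation mu0 := (lebesgue_0pi R).
Local Notation mu := (@lebesgue_measure R).
Local Notation I := (`]0, (pi : R)[%classic : set R).

Lemma ae_0pi_neq (a : R) : \forall x \ae mu0, x != a.
Proof.
exists [set a]; split => //.
  rewrite /= /mrestr; apply/eqP; rewrite -measure_le0.
  by rewrite -(lebesgue_measure_set1 a) le_measure// inE//; exact: measurableI.
by move=> x /= /negP; rewrite negbK => /eqP.
Qed.

Variable v : L2_0pi R.

Let v_int : mu0.-integrable setT (EFin \o (v : R -> R)).
Proof.
have := Lfun2_mul_Lfun1 (L2_Lfun v) (Lfun_0pi_continuous (@cst_continuous _ _ (1 : R))).
move/Lfun1_integrable; apply: eq_integrable => // x _.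
by rewrite /= mulr1.
Qed.

Let v_intI : mu.-integrable I (EFin \o (v : R -> R)).
Proof.
have /integrableP[mv vfin] := v_int.
apply/integrableP; split; first exact: measurable_funTS.
apply: le_lt_trans vfin.
rewrite [leRHS](@ge0_negligible_integral _ (measurableTypeR R) _ mu0 setT (~` I))//.
- rewrite setTD setCK le_eqVlt; apply/orP; left; apply/eqP.
  apply: eq_measure_integral => A mA AD.
  by rewrite /= /mrestr setIidl.
- by apply: measurableC; exact: measurable_itv.
- exact: measurableT_comp.
- by rewrite /= /mrestr setICl measure0.
Qed.

Hypothesis v_orth : forall n, L2_dot v (cos_basis R n) = 0.

(* [v] is orthogonal to the polynomials in [cos x], and the step polynomials make the
   indicator of [`]0, a]] a bounded pointwise limit of such polynomials. *)
Lemma Rintegral_initial_segment (a : R) : 0 < a < pi ->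
  \int[mu]_(x in `]0, a]) ((v : R -> R) \_ I) x = 0.
Proof.
move=> /andP[a0 ap].
(* Since cosine decreases on [[0, pi]], [q (cos x) < 1 / 2] means [x < a] there; division by 4 keeps
   [q] within [[0, 1]] on the range of cosine. *)
pose q (y : R) := 1 / 2 + (cos a - y) / 4.
pose Q : {poly R} := (1 / 2 + cos a / 4)%:P - (1 / 4)%:P * 'X.
have QE y : Q.[y] = q y by rewrite /Q !hornerE /q; field.
pose g j x := (step_poly R j).[q (cos x)].
pose h : R -> R := \1_(`]0, a]%classic : set R).
have gint j : \int[mu0]_x (v x * g j x) = 0.
  rewrite -[RHS](Rintegral_cos_horner v_orth (step_poly R j \Po Q) 0).
  by apply: eq_Rintegral => x _; rewrite mul0r cos0 mulr1 horner_comp QE.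
have q01 x : 0 <= q (cos x) <= 1.
  have := cos_geN1 a; have := cos_le1 a; have := cos_geN1 x; have := cos_le1 x.
  by rewrite /q => *; apply/andP; split; lra.
have cg j : continuous (g j).
  rewrite (_ : g j = (horner (step_poly R j \Po Q)) \o cos).
    move=> x; apply: continuous_comp; first exact: continuous_cos.
    exact: continuous_horner.
  by apply/funext => x; rewrite /= horner_comp QE.
(* The point [x = a] is sent to the threshold [1 / 2] itself and is discarded as a null set. *)
have gh : \forall x \ae mu0, setT x -> (v x * g j x)%:E @[j --> \oo] --> (v x * h x)%:E.
  apply: filterS2 (ae_0pi R) (ae_0pi_neq a) => x /andP[x0 xp] xa _.
  apply: cvg_EFin; first exact: nearW.
  apply: cvgMr.
  have := q01 x => /andP[q0 q1].
  rewrite /h indicE; have [lexa|ltax] := leP x a.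
    rewrite mem_set/=; last by rewrite in_itv/= x0.
    apply: step_poly_cvg1; rewrite q0/= /q.
    suff : cos a < cos x by lra.
    by rewrite ltr_cos ?in_itv/= ?(ltW x0) ?(ltW a0) ?(ltW xp) ?(ltW ap)// lt_neqAle xa.
  rewrite memNset/=; last by rewrite in_itv/= x0/= leNgt ltax.
  apply: step_poly_cvg0; rewrite q1 andbT /q.
  suff : cos x < cos a by lra.
  by rewrite ltr_cos ?in_itv/= ?(ltW x0) ?(ltW a0) ?(ltW xp) ?(ltW ap).
have mh : measurable_fun setT h by exact: measurable_indic.
have mv := L2_measurable v.
have mg j : measurable_fun setT (g j) by exact: continuous_measurable_fun.
have hL : h \in Lfun mu0 2%:E.
  apply: (@Lfun_0pi_bounded _ _ 1) => // x _.
  by rewrite /h indicE; case: (_ \in _); rewrite ?normr1 ?normr0.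
have gL j : g j \in Lfun mu0 2%:E by exact: Lfun_0pi_continuous.
have vhL : (v : R -> R) \* h \in Lfun mu0 1 by apply: Lfun2_mul_Lfun1 => //; exact: L2_Lfun.
(* The step polynomials take values in [[0, 1]], so the absolute value of [v] dominates; it is
   integrable because the interval has finite measure. *)
have [_ _ lim0] : [/\ mu0.-integrable setT (fun x => (v x * h x)%:E),
    (\int[mu0]_x `|(v x * g j x)%:E - (v x * h x)%:E|)%E @[j --> \oo] --> 0%E
  & (\int[mu0]_x (v x * g j x)%:E)%E @[j --> \oo] --> (\int[mu0]_x (v x * h x)%:E)%E].
  apply: (@dominated_convergence _ _ _ mu0 setT measurableT
    (fun j x => (v x * g j x)%:E) (fun x => (v x * h x)%:E) (fun x => (`|v x|)%:E)).
  - by move=> j; apply/measurable_EFinP; apply: measurable_funM; [exact: mv|exact: mg].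
  - by apply/measurable_EFinP; apply: measurable_funM; [exact: mv|exact: mh].
  - exact: gh.
  - exact: (integrable_abse v_int).
  - apply: nearW => x j _; rewrite lee_fin normrM ler_piMr//.
    have /andP[g0 g1] := step_poly_bounds j (q01 x).
    by rewrite /g ger0_norm.
have E0 : (\int[mu0]_x (v x * h x)%:E)%E = 0%E.
  apply/esym; apply: (cvg_unique (@ereal_hausdorff _) _ lim0).
  apply: cvg_near_cst; apply: nearW => j.
  have := gint j; rewrite /Rintegral => fine0.
  rewrite -[LHS]fineK ?fine0//; apply: integrable_fin_num => //.
  by apply/Lfun1_integrable; apply: Lfun2_mul_Lfun1 => //; exact: L2_Lfun.
transitivity (\int[mu]_(x in I) (v x * h x)).
  rewrite Rintegral_mkcond [RHS]Rintegral_mkcond; apply: eq_Rintegral => x _.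
  rewrite /patch /h indicE; case: (x \in `]0, a]%classic); case: (x \in I) => //=.
  - by rewrite mulr1.
  - by rewrite mulr0.
by rewrite -(Rintegral_0pi vhL) /Rintegral E0.
Qed.

(** The indefinite integral of [v] vanishes identically on the interval, and by Lebesgue
    differentiation its derivative is [v] almost everywhere. *)
Lemma cos_basis_total : v = 0.
Proof.
pose f := (v : R -> R) \_ I.
pose F x := \int[mu]_(t in `]0, x]) f t.
have mI : measurable (I : set (measurableTypeR R)) by exact: measurable_itv.
have fint : mu.-integrable setT (EFin \o f).
  have := (@integrable_mkcond _ (measurableTypeR R) R mu I (EFin \o (v : R -> R)) mI).1 v_intI.
  by apply: eq_integrable => // x _; rewrite /= /f /patch; case: ifP.
have F0 x : 0 < x < pi -> F x = 0 by exact: Rintegral_initial_segment.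
have fi y : mu.-integrable [set` Interval (BRight 0) (BRight y)] (EFin \o f).
  exact: (integrableS _ _ _ fint).
have := @FTC1 R f (BRight 0) fi (integrable_locally_restrict mI v_intI).
move=> H; apply/L2P.
have muF : Filter (almost_everywhere mu).
  exact: (ae_filter_ringOfSetsType (T := measurableTypeR R)).
have [N [mN N0 NH]] : \forall x \ae mu, 0 < x < pi -> v x = 0.
  apply: filterS H => x Hx /andP[x0 xp].
  have [|_ fx] := Hx; first exact: x0.
  have -> : v x = f x by rewrite /f patchE mem_set//= in_itv/= x0.
  rewrite -fx derive1E -[RHS](derive_cst (0 : R) x 1); apply: near_eq_derive.
  near=> y; apply: (F0 y); apply/andP; split; near: y.
    exact: lt_nbhsr.
  exact: lt_nbhsl.
have vN : \forall x \ae mu0, 0 < x < pi -> v x = 0.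
  exists N; split => //.
  rewrite /= /mrestr; apply/eqP; rewrite -measure_le0 -N0 le_measure// inE//.
  exact: measurableI.
apply: filterS3 vN (ae_0pi R) (L2_0E mu0) => x h1 h2 h3 _.
exact: etrans (h1 h2) (esym (h3 Logic.I)).
Unshelve. all: by end_near. Qed.

End cos_total.

(** * The shape of the eigenfunctions *)

Section one_sided.
Context (R : realType).
Implicit Types (f g : R -> R) (c d x l : R).

Lemma is_derive_continuous f x df : is_derive x 1 f df -> {for x, continuous f}.
Proof.
move=> h; apply/differentiable_continuous/derivable1_diffP.
exact: ex_derive.
Qed.

Lemma eq_at_left f g c d : c < d ->
  {for d, continuous f} -> {for d, continuous g} ->
  (forall x, c < x < d -> f x = g x) -> f d = g d.
Proof.
move=> cd cf cg fg.
have h1 : f x @[x --> d^'-] --> f d by apply: cvg_at_left_filter; exact: cf.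
have h2 : f x @[x --> d^'-] --> g d.
  apply: (@cvg_trans _ (g x @[x --> d^'-])).
    apply: near_eq_cvg; near=> x; apply/esym/fg; apply/andP; split; near: x.
      exact: nbhs_left_gt.
    exact: nbhs_left_lt.
  by apply: cvg_at_left_filter; exact: cg.
exact: (cvg_unique (@norm_hausdorff _ _) h1 h2).
Unshelve. all: by end_near. Qed.

Lemma cvg_at_left_reflect f c d l :
  f x @[x --> (c - d)^'+] --> l -> f (c - x) @[x --> d^'-] --> l.
Proof.
move=> /cvgrPdist_lt fl; apply/cvgrPdist_lt => e e0.
have := fl e e0; rewrite !near_withinE => -[/= r r0 hr].
exists r => //= x /= dx xd; apply: hr => /=.
  by rewrite (_ : c - d - (c - x) = - (d - x)) ?normrN//; ring.
by rewrite ltrD2l ltrN2.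
Qed.

End one_sided.

(** * Uniqueness for the initial value problem *)

Section fucik_ode.
Context (R : realType).
Implicit Types (a b c d x y : R) (u du v dv : R -> R).

Definition fucik_rhs a b y : R := a * Num.max y 0 - b * Num.max (- y) 0.

(** The second order equation as a first order system. [du] is a function of its own, so that
    translates and reflections of a solution come with an explicit derivative. *)
Definition fucik_ode a b c d u du : Prop := forall x, c < x < d ->
  is_derive x 1 u (du x) /\ is_derive x 1 du (- fucik_rhs a b (u x)).

Lemma fucik_rhs_lipschitz a b y z : 0 < a -> 0 < b ->
  `|fucik_rhs a b y - fucik_rhs a b z| <= (a + b) * `|y - z|.
Proof.
move=> a0 b0.
have mx (s t : R) : `|Num.max s 0 - Num.max t 0| <= `|s - t|.
  have [s0|s0] := leP s 0; have [t0|t0] := leP t 0.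
  - by rewrite subrr normr0.
  - by rewrite sub0r normrN gtr0_norm// distrC gtr0_norm; lra.
  - by rewrite subr0 gtr0_norm// gtr0_norm; lra.
  - exact: lexx.
rewrite /fucik_rhs opprD opprK addrACA -mulrBr -[X in _ + X]opprK opprD opprK -mulrBr.
apply: (le_trans (ler_normB _ _)); rewrite !normrM (gtr0_norm a0) (gtr0_norm b0) mulrDl.
apply: lerD; (apply: ler_wpM2l; first exact: ltW); first exact: mx.
by apply: (le_trans (mx _ _)); rewrite opprK addrC distrC.
Qed.

(* Gronwall: [((u - v)^2 + (du - dv)^2) * exp (- (1 + a + b) x)] is nonincreasing. *)
Lemma fucik_ode_unique a b c d u du v dv y0 y1 : 0 < a -> 0 < b ->
  fucik_ode a b c d u du -> fucik_ode a b c d v dv ->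
  u x @[x --> c^'+] --> y0 -> du x @[x --> c^'+] --> y1 ->
  v x @[x --> c^'+] --> y0 -> dv x @[x --> c^'+] --> y1 ->
  forall x, c < x < d -> u x = v x /\ du x = dv x.
Proof.
move=> a0 b0 su sv lu ldu lv ldv.
(* In the derivative of [D], the cross term [2 p q] is at most [p^2 + q^2], which accounts for the
   1; the Lipschitz constant of the right-hand side accounts for [a + b]. *)
pose K := 1 + (a + b).
pose D x := (u x - v x) ^+ 2 + (du x - dv x) ^+ 2.
pose E x := D x * expR (- K * x).
pose dE x := (2 * (u x - v x) * (du x - dv x)
   + 2 * (du x - dv x) * (fucik_rhs a b (v x) - fucik_rhs a b (u x)) - K * D x) * expR (- K * x).
have D_ge0 x : 0 <= D x by rewrite /D addr_ge0// sqr_ge0.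
have dEP x : c < x < d -> is_derive x 1 E (dE x).
  move=> xcd; have [ux dux] := su x xcd; have [vx dvx] := sv x xcd.
  have w := is_deriveB ux vx; have dw := is_deriveB dux dvx.
  have e := @is_derive_comp_affine R expR (- K) 0 x _ (is_derive_expR _).
  have h := is_deriveM (is_deriveD (is_deriveX 2 w) (is_deriveX 2 dw)) e.
  rewrite (_ : E = (((u - v) ^+ 2 + (du - dv) ^+ 2) * (fun y => expR (- K * y + 0)))); last first.
    by apply/funext => y; rewrite /E /D !fctE addr0.
  apply: (is_derive_eq h); rewrite /dE /D !fctE /GRing.scale/= addr0 expr1.
  by ring.
have dE_le0 x : dE x <= 0.
  rewrite /dE pmulr_lle0 ?expR_gt0// subr_le0 /K /D.
  have := fucik_rhs_lipschitz (v x) (u x) a0 b0.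
  set p := u x - v x; set q := du x - dv x; set r := fucik_rhs a b (v x) - fucik_rhs a b (u x) => hr.
  have hr' : `|r| <= (a + b) * `|p| by rewrite /p (distrC (u x)).
  have h1 : 2 * p * q <= p ^+ 2 + q ^+ 2 by have := sqr_ge0 (p - q); nra.
  have h2 : 2 * q * r <= (a + b) * (p ^+ 2 + q ^+ 2).
    have h3 : q * r <= (a + b) * (`|p| * `|q|).
      apply: (le_trans (ler_norm _)); rewrite normrM.
      by rewrite mulrC (le_trans (ler_wpM2r _ hr'))// mulrA.
    have h4 : 2 * (`|p| * `|q|) <= p ^+ 2 + q ^+ 2.
      rewrite -(real_normK (num_real p)) -(real_normK (num_real q)).
      by have := sqr_ge0 (`|p| - `|q|); nra.
    have ab : 0 <= a + b by rewrite addr_ge0 ?ltW.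
    by have := ler_wpM2l ab h4; lra.
  by lra.
move=> x /andP[cx xd].
have Edec y : c < y <= x -> E x <= E y.
  move=> /andP[cy yx].
  have in_cd z : y <= z <= x -> c < z < d.
    by move=> /andP[yz zx]; rewrite (lt_le_trans cy yz) (le_lt_trans zx xd).
  apply: (@ler0_derive1_nincr _ E y x) => //.
  - move=> z; rewrite in_itv/= => /andP[yz zx].
    have zcd : c < z < d by apply: in_cd; rewrite !ltW.
    by have h := dEP z zcd; exact: ex_derive.
  - move=> z; rewrite in_itv/= => /andP[yz zx].
    have zcd : c < z < d by apply: in_cd; rewrite !ltW.
    by have h := dEP z zcd; rewrite derive1E derive_val.
  - apply: derivable_within_continuous => z; rewrite in_itv/= => yzx.
    by have h := dEP z (in_cd z yzx); exact: ex_derive.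
(* The initial data are one-sided limits, so [E] tends to 0 at [c] from the right and, being
   nonincreasing, is nowhere positive. *)
have E0 : E y @[y --> c^'+] --> 0.
  rewrite (_ : 0 = ((y0 - y0) ^+ 2 + (y1 - y1) ^+ 2) * expR (- K * c)); last first.
    by rewrite !subrr !expr0n/= addr0 mul0r.
  apply: cvgM; last first.
    apply: cvg_at_right_filter.
    apply: (@continuous_comp _ _ _ ( *%R (- K)) expR); [exact: mulrl_continuous|exact: continuous_expR].
  apply: cvgD.
  - apply: (@cvg_comp _ _ _ (fun y => u y - v y) (fun z => z ^+ 2) _ (nbhs (y0 - y0))).
      exact: cvgB lu lv.
    exact: exprn_continuous.
  - apply: (@cvg_comp _ _ _ (fun y => du y - dv y) (fun z => z ^+ 2) _ (nbhs (y1 - y1))).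
      exact: cvgB ldu ldv.
    exact: exprn_continuous.
have : E x <= 0.
  apply: (cvgr_to_ge E0); near=> y; apply: Edec; apply/andP; split; near: y.
    exact: nbhs_right_gt.
  exact: nbhs_right_le.
rewrite /E pmulr_lle0 ?expR_gt0// => Dx.
have : D x == 0 by rewrite eq_le Dx D_ge0.
rewrite /D paddr_eq0 ?sqr_ge0// !sqrf_eq0 !subr_eq0.
by move=> /andP[/eqP -> /eqP ->].
Unshelve. all: by end_near. Qed.

End fucik_ode.

Section triangle_wave.
Context (R : realType).

(** The even, [2 pi]-periodic extension of the identity of [[0, pi]]; written through cosine, it
    inherits these symmetries directly. *)
Definition triangle_wave (y : R) : R := acos (cos y).

Lemma triangle_wave_continuous : continuous triangle_wave.
Proof.
move=> y.
have ca : {within `[cos (pi : R), cos 0], continuous (@acos R)}.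
  apply: (@segment_can_ge_continuous _ 0 pi (@cos R) acos (pi_ge0 R)).
    by apply: continuous_subspaceT => x; exact: continuous_cos.
  exact: cosK.
have cy z : `[cos (pi : R), cos 0]%classic (cos z).
  by rewrite /= in_itv/= cospi cos0 cos_geN1 cos_le1.
have := (subspace_continuousP _ _).1 ca (cos y) (cy y).
move=> acy V hV; have VW := acy V hV.
rewrite nbhs_filterE/= /within/= in VW.
have := @continuous_cos R y _ VW; apply: (@filterS _ (nbhs y)) => z /=.
by apply; exact: cy.
Qed.

Lemma triangle_wave_bounds y : 0 <= triangle_wave y <= pi.
Proof. by rewrite acos_ge0 ?acos_lepi// cos_geN1 cos_le1. Qed.

Lemma cos_triangle_wave y : cos (triangle_wave y) = cos y.
Proof. by rewrite acosK// in_itv/= cos_geN1 cos_le1. Qed.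

Lemma triangle_wave_id y : 0 <= y <= pi -> triangle_wave y = y.
Proof. by move=> y0; rewrite /triangle_wave cosK. Qed.

End triangle_wave.

Section fucik_profile.
Context (R : realType).
Implicit Types (ra rb s h A B x : R) (n : nat).

(* Half a period of the eigenfunction: [A * cos (ra * x)] up to its zero [s], then
   [- B * cos (rb * (h - x))] up to its minimum [h]; the [min] and [max] freeze each
   of the two terms at its own zero. *)
Definition fucik_profile ra rb s h A B x : R :=
  A * cos (ra * Num.min x s) - B * cos (rb * (h - Num.max x s)).

(** For [n > 0], the even function of period [2 pi / n] that agrees with [p] on [[0, pi / n]]. *)
Definition fucik_wave n (p : R -> R) x : R := p (triangle_wave (n%:R * x) / n%:R).

Lemma fucik_wave_continuous n p : continuous p -> continuous (fucik_wave n p).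
Proof.
move=> cp x; apply: (@continuous_comp _ _ _ (fun x => triangle_wave (n%:R * x) / n%:R) p).
  have c1 : {for x, continuous (@triangle_wave R \o ( *%R n%:R))}.
    by apply: continuous_comp; [exact: mulrl_continuous|exact: triangle_wave_continuous].
  exact: (cvgMl c1).
exact: cp.
Qed.

Lemma fucik_profile_continuous ra rb s h A B : continuous (fucik_profile ra rb s h A B).
Proof.
move=> x; apply: cvgB; apply: cvgMr.
- apply: (@continuous_comp _ _ _ (fun x => ra * Num.min x s) cos); last exact: continuous_cos.
  apply: cvgMr; apply: continuous_min; [exact: cvg_id|exact: cvg_cst].
- apply: (@continuous_comp _ _ _ (fun x => rb * (h - Num.max x s)) cos); last exact: continuous_cos.
  apply: cvgMr; apply: cvgB; first exact: cvg_cst.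
  apply: continuous_max; [exact: cvg_id|exact: cvg_cst].
Qed.

End fucik_profile.

Section trigonometric_solutions.
Context (R : realType).

Lemma trig_fucik_ode (a b c d k e A : R) :
  (forall x, c < x < d -> fucik_rhs a b (A * cos (k * x + e)) = k ^+ 2 * (A * cos (k * x + e))) ->
  fucik_ode a b c d (fun x => A * cos (k * x + e)) (fun x => - (A * k) * sin (k * x + e)).
Proof.
move=> hrhs x xcd; rewrite hrhs//.
have hc := @is_derive_comp_affine R cos k e x _ (is_derive_cos _).
have hs := @is_derive_comp_affine R sin k e x _ (is_derive_sin _).
split.
- have h := is_deriveZ A hc; refine (is_derive_eq h _).
  by rewrite /GRing.scale/=; ring.
- have h := is_deriveZ (- (A * k)) hs; refine (is_derive_eq h _).
  by rewrite /GRing.scale/=; ring.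
Qed.

Lemma fucik_rhs_ge0 (a b y : R) : 0 <= y -> fucik_rhs a b y = a * y.
Proof. by move=> y0; rewrite /fucik_rhs max_l// max_r ?oppr_le0// mulr0 subr0. Qed.

Lemma fucik_rhs_le0 (a b y : R) : y <= 0 -> fucik_rhs a b y = b * y.
Proof. by move=> y0; rewrite /fucik_rhs max_r// max_l ?oppr_ge0// mulr0 sub0r mulrN opprK. Qed.

End trigonometric_solutions.

(** Membership in [Gamma] says that a quarter period of [cos (ra x)], which is [s], and a quarter
    period of [cos (rb x)] add up to [h]. *)
Lemma fucik_Gamma_half_periods (R : realType) (n : nat) (a b : R) : (0 < n)%N ->
  fucik_Gamma n a b -> let ra := Num.sqrt a in let rb := Num.sqrt b in
  let s := pi / (2 * ra) in let h := pi / n%:R in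
  [/\ 0 < ra /\ 0 < rb, ra * s = pi / 2, rb * (h - s) = pi / 2, n%:R * h = pi
    & 2 / n%:R = ra^-1 + rb^-1].
Proof.
move=> n0 [a0 b0 G] ra rb s h; rewrite -/ra -/rb in G.
have ra0 : 0 < ra by rewrite sqrtr_gt0.
have rb0 : 0 < rb by rewrite sqrtr_gt0.
have nR0 : 0 < n%:R :> R by rewrite ltr0n.
have pi0 := pi_gt0 R.
rewrite /s /h; move: (pi : R) pi0 G => p p0 G.
have E : 2 / n%:R = ra^-1 + rb^-1.
  have -> : ra^-1 + rb^-1 = (n%:R / 2 * (p / ra) + n%:R / 2 * (p / rb)) * (2 / n%:R / p).
    by field; rewrite !gt_eqF.
  by rewrite G; field; rewrite !gt_eqF.
split => //.
- by field; rewrite gt_eqF.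
- have -> : p / n%:R = p / 2 * (ra^-1 + rb^-1) by rewrite -E; field; rewrite gt_eqF.
  by field; rewrite !gt_eqF.
- by rewrite mulrC divfK// gt_eqF.
Qed.

(** * Solving the equation, one half period after another *)

Section eigenfunction_shape.
Context (R : realType) (n : nat) (a b : R) (u du : R -> R).
Hypotheses (n0 : (0 < n)%N) (Gab : fucik_Gamma n a b).
Hypotheses (su : fucik_ode a b 0 pi u du) (u0 : 0 < u 0).
Hypotheses (lu : u x @[x --> 0^'+] --> u 0) (ldu : du x @[x --> 0^'+] --> 0).

Local Notation ra := (Num.sqrt a).
Local Notation rb := (Num.sqrt b).
Let s : R := pi / (2 * ra).
Let h : R := pi / n%:R.
Let A : R := u 0.
(** The amplitude of the negative part, forced by matching the slopes [- A ra] and [- B rb] at the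
    zero [s]. *)
Let B : R := A * ra / rb.

Let a0 : 0 < a. Proof. by case: Gab. Qed.
Let b0 : 0 < b. Proof. by case: Gab. Qed.
Let ra0 : 0 < ra. Proof. by rewrite sqrtr_gt0. Qed.
Let rb0 : 0 < rb. Proof. by rewrite sqrtr_gt0. Qed.
Let nR0 : 0 < n%:R :> R. Proof. by rewrite ltr0n. Qed.
Let ra2 : ra ^+ 2 = a. Proof. by rewrite sqr_sqrtr// ltW. Qed.
Let rb2 : rb ^+ 2 = b. Proof. by rewrite sqr_sqrtr// ltW. Qed.
Let pi0 : 0 < (pi : R). Proof. exact: pi_gt0. Qed.
Let s0 : 0 < s. Proof. by rewrite divr_gt0// mulr_gt0. Qed.
Let h0 : 0 < h. Proof. by rewrite divr_gt0. Qed.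
Let ras : ra * s = pi / 2. Proof. by case: (fucik_Gamma_half_periods n0 Gab). Qed.
Let rbhs : rb * (h - s) = pi / 2. Proof. by case: (fucik_Gamma_half_periods n0 Gab). Qed.
Let nh : n%:R * h = pi. Proof. by case: (fucik_Gamma_half_periods n0 Gab). Qed.
Let sh : s < h.
Proof. by rewrite -subr_gt0 -(pmulr_rgt0 _ rb0) rbhs divr_gt0. Qed.
Let hpi : h <= pi. Proof. by rewrite ler_pdivrMr//; apply: ler_peMr; [exact: ltW|rewrite ler1n]. Qed.
Let A0 : 0 < A. Proof. exact: u0. Qed.
Let B0 : 0 < B. Proof. by rewrite divr_gt0// mulr_gt0. Qed.
Let Brb : B * rb = A * ra. Proof. by rewrite /B divfK// gt_eqF. Qed.

Let cu x : 0 < x < pi -> {for x, continuous u}.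
Proof. by move=> /su[h1 _]; exact: is_derive_continuous h1. Qed.

Let cdu x : 0 < x < pi -> {for x, continuous du}.
Proof. by move=> /su[_ h1]; exact: is_derive_continuous h1. Qed.

Let su_sub c d : 0 <= c -> d <= pi -> fucik_ode a b c d u du.
Proof.
by move=> c0 dp x /andP[cx xd]; apply: su; rewrite (le_lt_trans c0)//= (lt_le_trans xd).
Qed.

Let cos_affine_continuous (k e x : R) : {for x, continuous (fun x => cos (k * x + e))}.
Proof.
exact: is_derive_continuous (@is_derive_comp_affine R cos k e x _ (is_derive_cos _)).
Qed.

Let sin_affine_continuous (k e x : R) : {for x, continuous (fun x => sin (k * x + e))}.
Proof.
exact: is_derive_continuous (@is_derive_comp_affine R sin k e x _ (is_derive_sin _)).
Qed.

(** As long as the cosine is positive the equation is linear, so the cosine is the solution with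
    data [(u 0, 0)]. Its zero [s] ends the first stage; the second restarts there with data
    [(0, - A ra)]. *)
Let stage1 x : 0 < x < s ->
  u x = A * cos (ra * x + 0) /\ du x = - (A * ra) * sin (ra * x + 0).
Proof.
have cA y : {for y, continuous (fun x => A * cos (ra * x + 0))}.
  by apply: cvgMr; exact: cos_affine_continuous.
have sA y : {for y, continuous (fun x => - (A * ra) * sin (ra * x + 0))}.
  by apply: cvgMr; exact: sin_affine_continuous.
apply: (fucik_ode_unique a0 b0 _ (@trig_fucik_ode R a b 0 s ra 0 A _) lu ldu).
- by apply: su_sub => //; exact: ltW (lt_le_trans sh hpi).
- move=> y /andP[y0 ys]; rewrite fucik_rhs_ge0 ?ra2//.
  rewrite mulr_ge0 ?ltW// addr0 cos_gt0_pihalf// (@lt_trans _ _ 0) ?oppr_lt0 ?mulr_gt0//=.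
  by rewrite -ras ltr_pM2l.
- by have := cvg_at_right_filter (cA 0); rewrite mulr0 addr0 cos0 mulr1.
- by have := cvg_at_right_filter (sA 0); rewrite mulr0 addr0 sin0 mulr0.
Qed.

Let spi : 0 < s < pi. Proof. by rewrite s0 (lt_le_trans sh). Qed.

Let us : u s = 0.
Proof.
rewrite (eq_at_left s0 (cu spi) (_ : {for s, continuous (fun x => A * cos (ra * x + 0))})).
- by rewrite addr0 ras cos_pihalf mulr0.
- by apply: cvgMr; exact: cos_affine_continuous.
- by move=> x /stage1[].
Qed.

Let dus : du s = - (A * ra).
Proof.
rewrite (eq_at_left s0 (cdu spi) (_ : {for s, continuous (fun x => - (A * ra) * sin (ra * x + 0))})).
- by rewrite addr0 ras sin_pihalf mulr1.
- by apply: cvgMr; exact: sin_affine_continuous.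
- by move=> x /stage1[].
Qed.

Let stage2 x : s < x < h ->
  u x = - B * cos (rb * x + - (rb * h)) /\ du x = - (- B * rb) * sin (rb * x + - (rb * h)).
Proof.
have arg : rb * s + - (rb * h) = - (pi / 2) by rewrite -rbhs; ring.
have cA y : {for y, continuous (fun x => - B * cos (rb * x + - (rb * h)))}.
  by apply: cvgMr; exact: cos_affine_continuous.
have sA y : {for y, continuous (fun x => - (- B * rb) * sin (rb * x + - (rb * h)))}.
  by apply: cvgMr; exact: sin_affine_continuous.
apply: (fucik_ode_unique a0 b0 (c := s) (d := h) _ (@trig_fucik_ode R a b s h rb (- (rb * h)) (- B) _)
  (y0 := 0) (y1 := - (A * ra))).
- by apply: su_sub => //; exact: ltW.
- move=> y /andP[sy yh]; rewrite fucik_rhs_le0 ?rb2//.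
  rewrite mulNr oppr_le0 mulr_ge0 ?ltW// cos_gt0_pihalf// -arg ltrD2r ltr_pM2l// sy/=.
  by rewrite (@lt_trans _ _ 0) ?divr_gt0// subr_lt0 ltr_pM2l.
- by rewrite -us; apply: cvg_at_right_filter; exact: cu.
- by rewrite -dus; apply: cvg_at_right_filter; exact: cdu.
- by have := cvg_at_right_filter (cA s); rewrite arg cosN cos_pihalf mulr0.
- by have := cvg_at_right_filter (sA s); rewrite arg sinN sin_pihalf mulrN1 opprK mulNr Brb.
Qed.

Let P := fucik_profile ra rb s h A B.

Let uP x : 0 < x < h -> u x = P x.
Proof.
move=> /andP[x0 xh]; rewrite /P /fucik_profile.
have [xs|sx|->] := ltgtP x s.
- by rewrite rbhs cos_pihalf mulr0 subr0 -[ra * x]addr0; apply: (stage1 _).1; rewrite x0.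
- rewrite ras cos_pihalf mulr0 sub0r -mulNr (stage2 _).1 ?sx//.
  by rewrite -[in RHS]cosN; congr (_ * cos _); ring.
- by rewrite us ras rbhs cos_pihalf !mulr0 subrr.
Qed.

Let duh : du x @[x --> h^'-] --> 0.
Proof.
have dh x : {for x, continuous (fun x => - (- B * rb) * sin (rb * x + - (rb * h)))}.
  by apply: cvgMr; exact: sin_affine_continuous.
apply: (@cvg_trans _ ((fun x => - (- B * rb) * sin (rb * x + - (rb * h))) x @[x --> h^'-])).
  apply: near_eq_cvg; near=> x; apply/esym; apply: (stage2 _).2; apply/andP; split; near: x.
    exact: nbhs_left_gt.
  exact: nbhs_left_lt.
by have := cvg_at_left_filter (dh h); rewrite subrr sin0 mulr0.
Unshelve. all: by end_near. Qed.

Let U := fucik_wave n P.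

Let cU : continuous U.
Proof. exact/fucik_wave_continuous/fucik_profile_continuous. Qed.

(** [U] depends on [x] only through [cos (n x)], so this makes it symmetric about [k h]. *)
Let cos_reflect k x : cos (n%:R * (k%:R * h + k%:R * h - x)) = cos (n%:R * x) :> R.
Proof.
rewrite (_ : n%:R * _ = k%:R * pi + k%:R * pi - n%:R * x); last by rewrite -nh; ring.
have := cos2Dsin2 (k%:R * (pi : R)); rewrite sin_natpi expr0n addr0 expr2 => c1.
by rewrite cosB cosD sinD !sin_natpi c1 !(mulr0, mul0r) subr0 addr0 mul0r addr0 mul1r.
Qed.

Let kh_lt k : (k < n)%N -> k%:R * h < pi.
Proof. by move=> kn; rewrite -nh ltr_pM2r// ltr_nat. Qed.

(* The derivative vanishes at each [k * h], so by uniqueness the solution is symmetric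
   about that point. *)
Let wave_steps k : (0 < k <= n)%N ->
  [/\ forall x, 0 < x < k%:R * h -> u x = U x,
      du x @[x --> (k%:R * h)^'-] --> 0
    & du x @[x --> (k%:R * h - h)^'+] --> 0].
Proof.
case: k => // k; elim: k => [|k IH] kn.
  rewrite mul1r subrr; split => // x /andP[x0 xh].
  rewrite uP ?x0// /U /fucik_wave triangle_wave_id; last first.
    apply/andP; split; first by apply: mulr_ge0; exact: ltW.
    by rewrite -nh ler_pM2l//; exact: ltW.
  by rewrite mulrC mulKf// gt_eqF.
have kn' : (0 < k.+1 <= n)%N by apply: ltnW.
have [uU dul dur] := IH kn'.
pose c : R := k.+1%:R * h.
have kS : k.+2%:R * h = c + h by rewrite /c -natr1 mulrDl mul1r.
have c0 : 0 < c by rewrite mulr_gt0// ltr0n.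
have cpi : c < pi by exact: kh_lt.
have c0pi : 0 < c < pi by rewrite c0.
have chpi : c + h <= pi by rewrite -kS -nh ler_pM2r// ler_nat.
have hc : h <= c by rewrite /c -natr1 mulrDl mul1r lerDr mulr_ge0// ltW.
have duc : du c = 0.
  have := cvg_at_left_filter (cdu c0pi).
  by move/(cvg_unique (@norm_hausdorff _ _)); apply; exact: dul.
have refl t0 : 0 < t0 < h -> u (c + t0) = u (c - t0) /\ du (c + t0) = - du (c - t0).
  have cc : 0 < 1 * 0 + c < pi by rewrite mulr0 add0r.
  have cc' : 0 < -1 * 0 + c < pi by rewrite mulr0 add0r.
  have key : forall t, 0 < t < h ->
      u (1 * t + c) = u (-1 * t + c) /\ du (1 * t + c) = - du (-1 * t + c).
    apply: (@fucik_ode_unique R a b 0 h (fun t => u (1 * t + c)) (fun t => du (1 * t + c))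
      (fun t => u (-1 * t + c)) (fun t => - du (-1 * t + c)) (u c) 0 a0 b0).
    - move=> t /andP[tgt0 th].
      have [h1 h2] : is_derive (1 * t + c) 1 u (du (1 * t + c)) /\
          is_derive (1 * t + c) 1 du (- fucik_rhs a b (u (1 * t + c))).
        by apply: su; rewrite mul1r; lra.
      split; [have h3 := is_derive_comp_affine h1 | have h3 := is_derive_comp_affine h2];
        by refine (is_derive_eq h3 _); ring.
    - move=> t /andP[tgt0 th].
      have [h1 h2] : is_derive (-1 * t + c) 1 u (du (-1 * t + c)) /\
          is_derive (-1 * t + c) 1 du (- fucik_rhs a b (u (-1 * t + c))).
        by apply: su; rewrite mulN1r; lra.
      split.
        by have h3 := is_derive_comp_affine h1; refine (is_derive_eq h3 _); ring.
      have h3 := is_deriveN (is_derive_comp_affine h2).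
      by refine (is_derive_eq h3 _); ring.
    - have h1 := is_derive_continuous (is_derive_comp_affine (su cc).1).
      by have := cvg_at_right_filter h1; rewrite mulr0 add0r.
    - have h1 := is_derive_continuous (is_derive_comp_affine (su cc).2).
      by have := cvg_at_right_filter h1; rewrite mulr0 add0r duc.
    - have h1 := is_derive_continuous (is_derive_comp_affine (su cc').1).
      by have := cvg_at_right_filter h1; rewrite mulr0 add0r.
    - have h1 := is_derive_continuous (is_derive_comp_affine (su cc').2).
      have h2 := cvgN (cvg_at_right_filter h1); rewrite mulr0 add0r duc oppr0 in h2. exact: h2.
  by move=> /key; rewrite mul1r mulN1r addrC [- t0 + c]addrC.
have durc : du x @[x --> c^'+] --> 0.
  by rewrite -duc; apply: cvg_at_right_filter; exact: cdu.
rewrite kS; split; last by rewrite addrK.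
- move=> x /andP[x0 xch].
  have [xc|cx|xc] := ltgtP x c.
  + by apply: uU; rewrite x0.
  + have xE : u (c + (x - c)) = u (c - (x - c)) by apply: (refl _ _).1; lra.
    rewrite (_ : c + (x - c) = x) in xE; last by ring.
    rewrite xE uU; last by apply/andP; split; rewrite -/c; lra.
    rewrite /U /fucik_wave /triangle_wave; congr (P (acos _ / _)).
    by rewrite -(cos_reflect k.+1 x); congr (cos (_ * _)); rewrite -/c; ring.
  + rewrite xc; apply: (eq_at_left c0); [exact: cu|exact: cU|exact: uU].
(* Near [c + h] the derivative mirrors the one near [c - h], whose right limit is the third
   component of the induction hypothesis. *)
- have h1 : (fun x => - du (c + c - x)) x @[x --> (c + h)^'-] --> 0.
    rewrite -[X in _ --> X]oppr0; apply: cvgN; apply: cvg_at_left_reflect.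
    by rewrite (_ : c + c - (c + h) = c - h)//; ring.
  apply: cvg_trans h1; apply: near_eq_cvg; near=> x.
  have xE : du (c + (x - c)) = - du (c - (x - c)).
    apply: (refl _ _).2; apply/andP; split.
      by rewrite subr_gt0; near: x; apply: nbhs_left_gt; rewrite ltrDl.
    by rewrite ltrBlDl; near: x; exact: nbhs_left_lt.
  rewrite (_ : c + (x - c) = x) in xE; last by ring.
  by rewrite xE; congr (- du _); ring.
Unshelve. all: by end_near. Qed.

Lemma fucik_eq_wave x : 0 < x < pi ->
  u x = fucik_wave n (fucik_profile (Num.sqrt a) (Num.sqrt b)
    (pi / (2 * Num.sqrt a)) (pi / n%:R) (u 0) (u 0 * Num.sqrt a / Num.sqrt b)) x.
Proof.
move=> x0pi; have [] := @wave_steps n; first by rewrite n0/=.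
by rewrite nh => + _ _; apply.
Qed.

End eigenfunction_shape.

(** * Normalisation of the two amplitudes *)

Section eigenfunction_normalization.
Context (R : realType).

Lemma fucik_profile_le (ra rb s h A B x : R) : 0 <= A -> 0 <= B -> 0 < ra -> 0 < rb ->
  ra * s = pi / 2 -> rb * (h - s) = pi / 2 -> 0 <= x <= h ->
  `|fucik_profile ra rb s h A B x| <= Num.max A B.
Proof.
move=> A0 B0 ra0 rb0 ras rbhs /andP[x0 xh]; rewrite /fucik_profile.
have key (C y : R) : 0 <= C -> C <= Num.max A B -> `|C * cos y| <= Num.max A B.
  move=> C0 CM; rewrite normrM (ger0_norm C0); apply: le_trans CM.
  by rewrite ler_piMr// cos_max.
have [xs|sx] := leP x s.
- by rewrite rbhs cos_pihalf mulr0 subr0 key// le_max lexx.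
- by rewrite ras cos_pihalf mulr0 sub0r normrN key// le_max lexx orbT.
Qed.

Lemma fucik_wave_arg (n : nat) (x : R) : (0 < n)%N ->
  0 <= triangle_wave (n%:R * x) / n%:R <= pi / n%:R.
Proof.
move=> n0; have /andP[t0 tp] := triangle_wave_bounds (n%:R * x).
by rewrite divr_ge0//= ler_pM2r// invr_gt0 ltr0n.
Qed.

(** The absolute value of [f] is [A] at 0 and [B] at [pi / n], and never exceeds the larger of the
    two. So the supremum condition becomes [Num.max A B = 1], which covers both cases of the
    explicit formula. *)
Lemma fucik_eigenfunction_wave (n : nat) (a b : R) (f : R -> R) : (0 < n)%N ->
  fucik_Gamma n a b -> fucik_eigenfunction a b f ->
  exists A B : R, [/\ 0 < A, 0 < B, A * Num.sqrt a = B * Num.sqrt b, Num.max A B = 1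
    & forall x, 0 <= x <= pi -> f x = fucik_wave n (fucik_profile (Num.sqrt a) (Num.sqrt b)
        (pi / (2 * Num.sqrt a)) (pi / n%:R) A B) x].
Proof.
move=> n0 Gab [[cf df _ ode [df0 dfpi]] f0 supf].
have pi0 := pi_gt0 R.
have /(continuous_within_itvP _ pi0)[_ f0r fpil] := cf.
have sf : fucik_ode a b 0 pi f (derive1 f).
  move=> x x0p; have [d1 d2] := df x x0p.
  have := ode x x0p; rewrite derive1Sn => /eqP; rewrite eqr_oppLR => /eqP od.
  split; [have h := derivableP d1|have h := derivableP d2].
    by refine (is_derive_eq h _); rewrite derive1E.
  by refine (is_derive_eq h _); rewrite -derive1E -od.
pose ra := Num.sqrt a; pose rb := Num.sqrt b.
pose s := pi / (2 * ra); pose h : R := pi / n%:R.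
pose A := f 0; pose B := A * ra / rb.
pose U := fucik_wave n (fucik_profile ra rb s h A B).
have fU x : 0 < x < pi -> f x = U x by exact: (fucik_eq_wave n0 Gab sf f0 f0r df0).
have cU : continuous U by exact/fucik_wave_continuous/fucik_profile_continuous.
have [[ra0 rb0] ras rbhs nh _] := fucik_Gamma_half_periods n0 Gab.
rewrite -/ra -/rb -/s -/h in ra0 rb0 ras rbhs nh.
have nR0 : 0 < n%:R :> R by rewrite ltr0n.
have B0 : 0 < B by rewrite divr_gt0// mulr_gt0.
have s0 : 0 < s by rewrite divr_gt0// mulr_gt0.
have h0 : 0 < h by rewrite divr_gt0.
have sh : s < h by rewrite -subr_gt0 -(pmulr_rgt0 _ rb0) rbhs divr_gt0.
have hpi : h <= pi by rewrite ler_pdivrMr//; apply: ler_peMr; [exact: ltW|rewrite ler1n].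
have U0 : U 0 = A.
  rewrite /U /fucik_wave mulr0 triangle_wave_id ?lexx ?pi_ge0// mul0r /fucik_profile.
  by rewrite min_l ?ltW// max_r ?ltW// mulr0 cos0 mulr1 rbhs cos_pihalf mulr0 subr0.
have Uh : U h = - B.
  rewrite /U /fucik_wave nh triangle_wave_id ?lexx ?pi_ge0// -/h /fucik_profile.
  by rewrite min_r ?ltW// max_l ?ltW// subrr mulr0 cos0 mulr1 ras cos_pihalf mulr0 sub0r.
have fUcc x : 0 <= x <= pi -> f x = U x.
  move=> /andP[]; rewrite le_eqVlt => /predU1P[<- _|x0].
    by rewrite U0.
  rewrite le_eqVlt => /predU1P[->|xp]; last by rewrite fU// x0.
  have h1 : f x @[x --> pi^'-] --> U pi.
    apply: (@cvg_trans _ (U x @[x --> (pi : R)^'-])); last first.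
      by apply: cvg_at_left_filter; exact: cU.
    apply: near_eq_cvg; near=> y; apply/esym/fU; apply/andP; split; near: y.
      exact: nbhs_left_gt.
    exact: nbhs_left_lt.
  exact: (cvg_unique (@norm_hausdorff _ _) fpil h1).
exists A, B; split => //.
- by rewrite divfK// gt_eqF.
apply/eqP; rewrite eq_le; apply/andP; split.
- rewrite -supf ge_max; apply/andP; split; apply: ub_le_sup.
  + exists (Num.max A B) => _ [x /= x0p <-].
    rewrite fUcc; last by move: x0p; rewrite in_itv.
    by apply: fucik_profile_le => //; [exact: ltW|exact: ltW|exact: fucik_wave_arg].
  + by exists 0 => /=; [rewrite in_itv/= lexx pi_ge0|rewrite gtr0_norm].
  + exists (Num.max A B) => _ [x /= x0p <-].
    rewrite fUcc; last by move: x0p; rewrite in_itv.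
    by apply: fucik_profile_le => //; [exact: ltW|exact: ltW|exact: fucik_wave_arg].
  + exists h => /=; first by rewrite in_itv/= hpi ltW.
    by rewrite fUcc ?Uh ?normrN ?gtr0_norm// hpi ltW.
- rewrite -supf; apply: ge_sup.
    by exists `|f 0|, 0 => //=; rewrite in_itv/= lexx pi_ge0.
  move=> _ [x /= x0p <-].
  rewrite fUcc; last by move: x0p; rewrite in_itv.
  by apply: fucik_profile_le => //; [exact: ltW|exact: ltW|exact: fucik_wave_arg].
Unshelve. all: by end_near. Qed.

End eigenfunction_normalization.

(** * Cosine coefficients of the eigenfunctions *)

Section antiderivative.
Context (R : realType).
Local Notation mu := (@lebesgue_measure R).
Local Notation I := (`]0, (pi : R)[%classic : set R).
Implicit Types (f F G : R -> R) (c x y k : R).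

(** With one antiderivative on a half-line, integrals over shifted or reflected intervals become
    differences of its values. *)
Lemma antiderivative_right f c : continuous f ->
  exists F, forall x, c < x -> is_derive x 1 F (f x).
Proof.
move=> cf; exists (fun x => \int[mu]_(t in `[c, x]) f t) => x cx.
have xx1 : x < x + 1 by rewrite ltrDl.
have fi : mu.-integrable `[c, x + 1]%classic (EFin \o f).
  apply: continuous_compact_integrable; first exact: segment_compact.
  exact: continuous_subspaceT.
have [dF FE] := continuous_FTC1_closed xx1 fi cx (cf x).
by have h := derivableP dF; refine (is_derive_eq h _); rewrite -derive1E.
Qed.

Lemma is_derive0_const f c d x y : c <= x -> x <= y -> y <= d ->
  (forall z, c <= z <= d -> is_derive z 1 f 0) -> f x = f y.
Proof.
move=> cx xy yd df.
have cf : {within `[x, y], continuous f}.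
  apply: derivable_within_continuous => z; rewrite in_itv/= => /andP[xz zy].
  by have h := df z _; apply: ex_derive; apply: h; rewrite (le_trans cx xz) (le_trans zy yd).
have df' z : z \in `]x, y[%R -> is_derive z 1 f ((fun=> 0) z).
  rewrite in_itv/= => /andP[xz zy]; apply: df.
  by rewrite (le_trans cx (ltW xz)) (le_trans (ltW zy) yd).
have [z _ /eqP] := MVT_segment xy df' cf.
by rewrite mul0r subr_eq0 => /eqP.
Qed.

(* Shifting by the period [q] rotates the pair of Fourier integrals of [W] at the
   frequency [m] by the angle [m * q]; it also preserves them. *)
Lemma Rintegral_even_periodic_cos (W : R -> R) (q : R) (m : nat) : continuous W ->
  (forall x, W (- x) = W x) -> (forall x, W (x + q) = W x) ->
  (forall x, W (x + pi *+ 2) = W x) -> 0 <= q -> cos (m%:R * q) != 1 ->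
  \int[mu]_(x in I) (W x * cos (m%:R * x)) = 0.
Proof.
move=> cW Wev Wq W2pi q0 cq.
pose M : R := m%:R.
(* All arguments met below lie in [[- pi, pi + q]], to the right of [c]. *)
pose c : R := - (pi + q + 1).
have cWc : continuous (fun x => W x * cos (M * x)).
  by move=> x; apply: cvgM; [exact: cW|exact: continuous_cosM].
have cWs : continuous (fun x => W x * sin (M * x)).
  move=> x; apply: cvgM; first exact: cW.
  exact: is_derive_continuous (is_derive_sinM M x).
have [Gc dGc] := antiderivative_right c cWc.
have [Gs dGs] := antiderivative_right c cWs.
have pi0 := pi_gt0 R; have pige0 := pi_ge0 R.
have cM : cos (M * (pi *+ 2)) = 1.
  have -> : M * (pi *+ 2) = (m%:R * pi) + m%:R * pi by rewrite /M; ring.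
  rewrite cosD sin_natpi mulr0 subr0.
  by have := cos2Dsin2 (m%:R * (pi : R)); rewrite sin_natpi expr0n addr0 expr2.
have sM : sin (M * (pi *+ 2)) = 0.
  have -> : M * (pi *+ 2) = (m * 2)%:R * pi by rewrite /M natrM; ring.
  exact: sin_natpi.
have cGc (k e x : R) : c < k * x + e -> is_derive x 1 (fun x => Gc (k * x + e))
    (k * (W (k * x + e) * cos (M * (k * x + e)))).
  by move=> h; exact: is_derive_comp_affine (dGc _ h).
have cGs (k e x : R) : c < k * x + e -> is_derive x 1 (fun x => Gs (k * x + e))
    (k * (W (k * x + e) * sin (M * (k * x + e)))).
  by move=> h; exact: is_derive_comp_affine (dGs _ h).
transitivity (Gc pi - Gc 0).
  apply: (@Rintegral_FTC _ Gc); first exact: cWc.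
  by move=> x /andP[x0 xp]; apply: dGc; rewrite /c; lra.
(* The cosine integrand is even and the sine integrand odd; hence this identity and [evens]. *)
have oddc : Gc 0 + Gc 0 = Gc pi + Gc (- pi).
  pose H x := Gc (1 * x + 0) + Gc (-1 * x + 0).
  suff : H 0 = H pi by rewrite /H !mulr0 !addr0 mul1r mulN1r.
  apply: (@is_derive0_const _ 0 pi) => // x /andP[x0 xp].
  have h1 : c < 1 * x + 0 by rewrite /c; lra.
  have h2 : c < -1 * x + 0 by rewrite /c; lra.
  have h := is_deriveD (cGc _ _ _ h1) (cGc _ _ _ h2).
  refine (is_derive_eq h _); rewrite ?mul1r ?mulN1r ?addr0.
  by rewrite Wev mulrN cosN subrr.
have evens : Gs pi = Gs (- pi).
  pose H x := Gs (1 * x + 0) - Gs (-1 * x + 0).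
  have : H 0 = H pi.
    apply: (@is_derive0_const _ 0 pi) => // x /andP[x0 xp].
    have h1 : c < 1 * x + 0 by rewrite /c; lra.
    have h2 : c < -1 * x + 0 by rewrite /c; lra.
    have h := is_deriveB (cGs _ _ _ h1) (cGs _ _ _ h2).
    refine (is_derive_eq h _); rewrite ?mul1r ?mulN1r ?addr0.
    by rewrite Wev mulrN sinN; ring.
  rewrite /H !mulr0 !addr0 mul1r mulN1r subrr => /esym/eqP.
  by rewrite subr_eq0 => /eqP.
have per : Gc (pi + q) - Gc (- pi + q) = Gc pi - Gc (- pi).
  pose H x := Gc (1 * x + pi) - Gc (1 * x + - pi).
  have : H 0 = H q.
    apply: (@is_derive0_const _ 0 q) => // x /andP[x0 xp].
    have h1 : c < 1 * x + pi by rewrite /c; lra.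
    have h2 : c < 1 * x + - pi by rewrite /c; lra.
    have h := is_deriveB (cGc _ _ _ h1) (cGc _ _ _ h2).
    refine (is_derive_eq h _); rewrite ?mul1r.
    have -> : x + pi = (x - pi) + pi *+ 2 by ring.
    by rewrite W2pi mulrDr cosD cM sM mulr1 mulr0 subr0 subrr.
  by rewrite /H mulr0 !add0r mul1r => ->; rewrite ![q + _]addrC.
(* [H] has derivative zero: [W] has period [q], and [cos (M (x + q))] expands by the addition
   formula. *)
have shift : Gc (pi + q) - cos (M * q) * Gc pi + sin (M * q) * Gs pi
   = Gc (- pi + q) - cos (M * q) * Gc (- pi) + sin (M * q) * Gs (- pi).
  pose H x := Gc (1 * x + q) - cos (M * q) * Gc x + sin (M * q) * Gs x.
  suff : H (- pi) = H pi by rewrite /H !mul1r => ->.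
  apply: (@is_derive0_const _ (- pi) pi) => //; first by lra.
  move=> x /andP[x0 xp].
  have cx : c < x by rewrite /c; lra.
  have h1 : c < 1 * x + q by rewrite /c; lra.
  have h := is_deriveD (is_deriveB (cGc _ _ _ h1) (is_deriveZ (cos (M * q)) (dGc x cx)))
     (is_deriveZ (sin (M * q)) (dGs x cx)).
  refine (is_derive_eq h _); rewrite ?mul1r.
  rewrite /GRing.scale/= Wq mulrDr cosD; ring.
(* The sine terms cancel by [evens], leaving the cosine integral over a full period equal to
   [cos (M q)] times itself. *)
have E : (1 - cos (M * q)) * (Gc pi - Gc (- pi)) = 0.
  have : (Gc (pi + q) - Gc (- pi + q)) - cos (M * q) * (Gc pi - Gc (- pi)) = 0.
    by move: shift; rewrite evens => shift; lra.
  by rewrite per => <-; ring.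
have /eqP := E; rewrite mulf_eq0 subr_eq0 eq_sym (negbTE cq)/= subr_eq0 => /eqP E2.
by move: oddc; rewrite -E2; lra.
Qed.

End antiderivative.

(** * Vanishing and positive cosine coefficients of a wave *)

Section wave_fourier.
Context (R : realType).
Local Notation mu := (@lebesgue_measure R).
Local Notation I := (`]0, (pi : R)[%classic : set R).
Implicit Types (p : R -> R) (n m : nat) (x y : R).

Lemma cos_neq1 (x : R) : 0 < x < pi *+ 2 -> cos x != 1.
Proof.
move=> /andP[x0 x2].
have xE : x = x / 2 + x / 2 by field.
have s0 : 0 < sin (x / 2) by apply: sin_gt0_pi; apply/andP; split; lra.
rewrite xE cosD; have := cos2Dsin2 (x / 2); rewrite !expr2 => c1.
have ss : 0 < sin (x / 2) * sin (x / 2) by rewrite mulr_gt0.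
by apply/eqP => E; lra.
Qed.

Lemma cos_add_2natpi n (y : R) : cos (y + n%:R * (pi *+ 2)) = cos y.
Proof.
elim: n => [|n IH]; first by rewrite mul0r addr0.
by rewrite -natr1 mulrDl mul1r addrA cosD2pi.
Qed.

(** For the period [q = 2 pi / n], the angle [m q] lies strictly between 0 and [2 pi], so its cosine
    is not 1. *)
Lemma Rintegral_wave_cos_lt n m p : continuous p -> (0 < m < n)%N ->
  \int[mu]_(x in I) (fucik_wave n p x * cos (m%:R * x)) = 0.
Proof.
move=> cp /andP[m0 mn].
have n0 : (0 < n)%N by exact: ltn_trans mn.
have nR0 : 0 < n%:R :> R by rewrite ltr0n.
have pi0 := pi_gt0 R.
apply: (@Rintegral_even_periodic_cos _ _ (pi *+ 2 / n%:R)).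
- exact: fucik_wave_continuous.
- by move=> x; rewrite /fucik_wave /triangle_wave mulrN cosN.
- move=> x; rewrite /fucik_wave /triangle_wave mulrDr.
  by rewrite [X in _ + X]mulrC divfK ?gt_eqF// cosD2pi.
- by move=> x; rewrite /fucik_wave /triangle_wave mulrDr cos_add_2natpi.
- by rewrite divr_ge0// mulrn_wge0 ?ltW.
- apply: cos_neq1; apply/andP; split.
    by rewrite mulr_gt0 ?ltr0n// divr_gt0// mulrn_wgt0.
  by rewrite mulrA ltr_pdivrMr// [ltRHS]mulrC ltr_pM2r ?ltr_nat// mulrn_wgt0.
Qed.

(* As [cos (n x)] has mean zero, the value of [p] at the middle of the half period may be
   subtracted from the wave; the difference has the sign of [cos (n x)]. *)
Lemma Rintegral_wave_cos_gt0 n p : (0 < n)%N -> continuous p ->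
  {in `[0, pi / n%:R] &, {homo p : x y /~ x < y}} ->
  0 < \int[mu]_(x in I) (fucik_wave n p x * cos (n%:R * x)).
Proof.
move=> n0 cp pdec.
have nR0 : 0 < n%:R :> R by rewrite ltr0n.
have pi0 := pi_gt0 R.
pose h : R := pi / n%:R.
have nh : n%:R * h = pi by rewrite /h mulrC divfK// gt_eqF.
have h0 : 0 < h by rewrite divr_gt0.
pose kap := p (h / 2).
pose F x := (fucik_wave n p x - kap) * cos (n%:R * x).
have cW : continuous (fucik_wave n p) by exact: fucik_wave_continuous.
have cF : continuous F.
  by move=> x; apply: cvgM; [apply: cvgB; [exact: cW|exact: cvg_cst]|exact: continuous_cosM].
have hin x : 0 <= x <= h -> x \in `[0, pi / n%:R] by rewrite in_itv.
have pin x : 0 <= x <= h -> n%:R * x \in `[0, pi].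
  by move=> /andP[x0 xh]; rewrite in_itv/= -nh ler_pM2l// xh andbT mulr_ge0// ltW.
have h2 : 0 <= h / 2 <= h by apply/andP; split; lra.
have cosh2 : cos (n%:R * (h / 2)) = 0 by rewrite mulrA nh cos_pihalf.
have Fpos_prof t : 0 <= t <= h -> 0 <= (p t - kap) * cos (n%:R * t).
  move=> th; have [t2|t2|->] := ltgtP t (h / 2); last by rewrite cosh2 mulr0.
  - apply: mulr_ge0; first by rewrite subr_ge0 ltW// pdec ?hin.
    by rewrite -cosh2 ltW// ltr_cos ?pin// ltr_pM2l.
  - apply: mulr_le0; first by rewrite subr_le0 ltW// pdec ?hin.
    by rewrite -cosh2 ltW// ltr_cos ?pin// ltr_pM2l.
have Fge0 x : 0 <= F x.
  have := Fpos_prof _ (fucik_wave_arg x n0).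
  by rewrite /F [X in cos X]mulrC divfK ?gt_eqF// cos_triangle_wave.
have Fgt0 x : 0 < x < h / 2 -> 0 < F x.
  move=> /andP[x0 xh2].
  have xh : 0 <= x <= h by apply/andP; split; lra.
  rewrite /F /fucik_wave triangle_wave_id; last by have := pin x xh; rewrite in_itv.
  rewrite [_ * x / _]mulrC mulKf ?gt_eqF//; apply: mulr_gt0.
    by rewrite subr_gt0 pdec ?hin.
  by rewrite -cosh2 ltr_cos ?pin// ltr_pM2l.
have [G dG] := antiderivative_right (-1) cF.
have E : \int[mu]_(x in I) (fucik_wave n p x * cos (n%:R * x)) = G pi - G 0.
  transitivity (\int[mu]_(x in I) (F x + kap * (cos (n%:R * x) * cos (0%:R * x)))).
    by apply: eq_Rintegral => x _; rewrite /F mul0r cos0; ring.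
  rewrite RintegralD//; last 2 first.
  - exact: continuous_integrable_0pi.
  - apply: continuous_integrable_0pi => x; apply: cvgMr; apply: cvgM; exact: continuous_cosM.
  rewrite RintegralZl//; last first.
    by apply: continuous_integrable_0pi => x; apply: cvgM; exact: continuous_cosM.
  rewrite Rintegral_cos_cos_neq ?mulr0 ?addr0; last by rewrite -lt0n.
  by apply: Rintegral_FTC => // x /andP[x0 _]; apply: dG; lra.
rewrite E.
(* Positivity is read off from [G]: it increases strictly over [[0, h / 2]], where [F > 0] inside,
   and does not decrease over the rest. *)
have mvt x y : 0 <= x -> x < y -> exists2 z, x < z < y & G y - G x = F z * (y - x).
  move=> x0 xy.
  have cG : {within `[x, y], continuous G}.
    apply: derivable_within_continuous => z; rewrite in_itv/= => /andP[xz _].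
    by have hz : is_derive z 1 G (F z) by [apply: dG; lra]; exact: ex_derive.
  have dG' z : z \in `]x, y[%R -> is_derive z 1 G (F z).
    by rewrite in_itv/= => /andP[xz _]; apply: dG; lra.
  by have [z zxy ->] := MVT xy dG' cG; exists z => //; move: zxy; rewrite in_itv.
have hpi : h <= pi by rewrite ler_pdivrMr//; apply: ler_peMr; [exact: ltW|rewrite ler1n].
have [z1 /andP[z10 z1h] e1] := mvt 0 (h / 2) (lexx _) (divr_gt0 h0 (ltr0Sn _ _)).
have h2pi : h / 2 < pi by lra.
have [z2 /andP[z20 z2h] e2] := mvt (h / 2) pi (ltW (divr_gt0 h0 (ltr0Sn _ _))) h2pi.
have F1 : 0 < F z1 * (h / 2 - 0) by rewrite mulr_gt0 ?Fgt0 ?z10//; lra.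
have F2 : 0 <= F z2 * (pi - h / 2) by rewrite mulr_ge0 ?Fge0//; lra.
by rewrite -(subrK (G (h / 2)) (G pi)) -addrA e1 e2 ltr_wpDl.
Qed.

End wave_fourier.

(** * Monotonicity of the profile and its distance to the cosine *)

Section profile_estimates.
Context (R : realType).
Implicit Types (ra rb s h A B x y : R).

Lemma cos_lipschitz x y : `|cos x - cos y| <= `|x - y|.
Proof.
wlog xy : x y / x <= y.
  move=> H; have [|/ltW] := leP x y; first exact: H.
  by move=> /H; rewrite distrC [`|y - x|]distrC.
have cc : {within `[x, y], continuous (@cos R)}.
  by apply: continuous_subspaceT => z; exact: continuous_cos.
have [z _ E] := MVT_segment xy (fun z _ => is_derive_cos z) cc.
rewrite distrC E normrM normrN [`|x - y|]distrC ler_piMl//.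
exact: sin_max.
Qed.

Section profile.
Context (ra rb s h A B : R).
Hypotheses (A0 : 0 < A) (B0 : 0 < B) (ra0 : 0 < ra) (rb0 : 0 < rb).
Hypotheses (ras : ra * s = pi / 2) (rbhs : rb * (h - s) = pi / 2).

Let s0 : 0 < s. Proof. by rewrite -(pmulr_rgt0 _ ra0) ras divr_gt0 ?pi_gt0. Qed.
Let sh : s < h. Proof. by rewrite -subr_gt0 -(pmulr_rgt0 _ rb0) rbhs divr_gt0 ?pi_gt0. Qed.

(** Both terms are nonincreasing on all of [[0, h]]; the first is strictly so before [s], the second
    after it. *)
Lemma fucik_profile_decreasing :
  {in `[0, h] &, {homo fucik_profile ra rb s h A B : x y /~ x < y}}.
Proof.
move=> y x; rewrite !in_itv/= => /andP[y0 yh] /andP[x0 xh] xy.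
have pi0 := pi_gt0 R.
have min_in z : 0 <= z -> ra * Num.min z s \in `[0, pi].
  move=> z0; rewrite in_itv/=; apply/andP; split.
    by apply: mulr_ge0; [exact: ltW|rewrite le_min z0 ltW].
  apply: (@le_trans _ _ (ra * s)); last by rewrite ras; lra.
  by rewrite ler_pM2l// ge_min lexx orbT.
have max_in z : z <= h -> rb * (h - Num.max z s) \in `[0, pi].
  move=> zh; rewrite in_itv/=; apply/andP; split.
    by apply: mulr_ge0; [exact: ltW|rewrite subr_ge0 ge_max zh ltW].
  apply: (@le_trans _ _ (rb * (h - s))); last by rewrite rbhs; lra.
  by rewrite ler_pM2l// lerD2l lerN2 le_max lexx orbT.
have le_cos z w : z \in `[0, pi : R] -> w \in `[0, pi : R] -> (cos z <= cos w) = (w <= z).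
  by move=> zi wi; rewrite !leNgt ltr_cos.
rewrite /fucik_profile; have [xs|] := boolP (x < s); last rewrite -leNgt => sx.
- apply: ltr_leB.
    rewrite ltr_pM2l// ltr_cos ?min_in// ltr_pM2l//.
    by rewrite (min_l (ltW xs)) lt_min xy.
  rewrite ler_pM2l// le_cos ?max_in// ler_pM2l// lerD2l lerN2.
  by rewrite ge_max !le_max lexx ?orbT (ltW xy).
- apply: ler_ltB.
    rewrite ler_pM2l// le_cos ?min_in// ler_pM2l//.
    by rewrite le_min !ge_min lexx ?orbT (ltW xy).
  rewrite ltr_pM2l// ltr_cos ?max_in// ltr_pM2l// ltrD2l ltrN2.
  by rewrite (max_l sx) lt_max xy.
Qed.

(** The amplitude error contributes [2 d] and the frequency error at most [n d h = pi d]. Beyond [s]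
    the same estimate is used after the reflection [cos (n x) = - cos (n (h - x))]. *)
Lemma fucik_profile_near_cos n d x : n * h = pi -> 0 <= x <= h ->
  `|A - 1| <= 2 * d -> `|B - 1| <= 2 * d ->
  `|ra - n| <= n * d -> `|rb - n| <= n * d ->
  `|fucik_profile ra rb s h A B x - cos (n * x)| <= (2 + pi) * d.
Proof.
move=> nh /andP[x0 xh] Ad Bd rad rbd.
have pi0 := pi_gt0 R.
have h0 : 0 < h := lt_trans s0 sh.
have key (C r y : R) : `|C - 1| <= 2 * d -> `|r - n| <= n * d -> 0 <= y <= h ->
    `|C * cos (r * y) - cos (n * y)| <= (2 + pi) * d.
  move=> Cd rd /andP[y0 yh].
  rewrite (_ : _ - _ = (C - 1) * cos (r * y) + (cos (r * y) - cos (n * y))); last by ring.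
  apply: (le_trans (ler_normD _ _)); rewrite [leRHS]mulrDl; apply: lerD.
    rewrite normrM -[2 * d]mulr1; apply: ler_pM => //; exact: cos_max.
  apply: (le_trans (cos_lipschitz _ _)); rewrite -mulrBl normrM (ger0_norm y0).
  apply: (@le_trans _ _ (n * d * h)); last by rewrite -nh mulrAC.
  by apply: ler_pM.
rewrite /fucik_profile; have [xs|sx] := leP x s.
- by rewrite rbhs cos_pihalf mulr0 subr0; apply: key => //; rewrite x0.
- rewrite ras cos_pihalf mulr0 sub0r.
  have -> : n * x = pi - n * (h - x) by rewrite mulrBr nh; ring.
  rewrite cosB cospi sinpi mul0r addr0 mulN1r opprK -normrN opprD opprK.
  by apply: key => //; apply/andP; split; lra.
Qed.

End profile.

(** [n] is the harmonic mean of [ra] and [rb], so it lies between them and no farther from the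
    smaller: the excess of the larger one controls both. The smaller amplitude is the ratio of the
    frequencies, whose distance to 1 is at most [2 d]. Exchanging [(ra, A)] with [(rb, B)] reduces
    to [rb <= ra]. *)
Lemma fucik_parameters_near (n ra rb A B : R) : 0 < n -> 0 < ra -> 0 < rb -> 0 < A -> 0 < B ->
  2 / n = ra^-1 + rb^-1 -> A * ra = B * rb -> Num.max A B = 1 ->
  let d := (Num.max ra rb - n) / n in
  [/\ `|A - 1| <= 2 * d, `|B - 1| <= 2 * d, `|ra - n| <= n * d & `|rb - n| <= n * d].
Proof.
move=> n0 ra0 rb0 A0 B0 E AB AB1 d.
wlog rab : ra rb A B ra0 rb0 A0 B0 E AB AB1 @d / rb <= ra.
  move=> H; have [|/ltW] := leP rb ra; first exact: H.
  move=> h; have [] := H rb ra B A rb0 ra0 B0 A0 _ _ _ h.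
  - by rewrite E addrC.
  - by [].
  - by rewrite maxC.
  - by rewrite /d [Num.max rb ra]maxC => *; split.
have dE : d = (ra - n) / n by rewrite /d max_l.
have hn : 2 * ra * rb = n * (ra + rb).
  have := congr1 (fun z => z * (n * ra * rb)) E.
  have -> : 2 / n * (n * ra * rb) = 2 * ra * rb by field; rewrite gt_eqF.
  by have -> : (ra^-1 + rb^-1) * (n * ra * rb) = n * (ra + rb) by field; rewrite !gt_eqF.
have n_ra : n <= ra by nra.
have rb_n : rb <= n by nra.
have ABle : A <= B by rewrite -(ler_pM2r ra0) AB ler_pM2l.
have B1 : B = 1 by rewrite -AB1 max_r.
have nd : n * d = ra - n by rewrite dE mulrC divfK// gt_eqF.
have d0 : 0 <= d by rewrite dE divr_ge0 ?subr_ge0// ltW.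
have A1 : A <= 1 by rewrite -B1.
have AE : A * ra = rb by rewrite AB B1 mul1r.
have rbE : n - rb <= ra - n by nra.
split.
- rewrite ler0_norm ?subr_le0//.
  rewrite -(ler_pM2l (mulr_gt0 n0 ra0)).
  have -> : n * ra * - (A - 1) = n * (ra - A * ra) by ring.
  have -> : n * ra * (2 * d) = 2 * ra * (n * d) by ring.
  by rewrite AE nd; nra.
- by rewrite B1 subrr normr0 mulr_ge0.
- by rewrite nd ger0_norm ?subr_ge0.
- by rewrite nd ler0_norm ?subr_le0// opprB.
Qed.

End profile_estimates.

(** * Convergence of the p-series for p > 1 *)

Section p_series.
Context (R : realType).

Lemma powR_telescope (e : R) (n : nat) : 0 < e -> (0 < n)%N ->
  n.+1%:R `^ (- (1 + e)) <= e^-1 * (n%:R `^ (- e) - n.+1%:R `^ (- e)) :> R.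
Proof.
move=> e0 n0; have nR0 : 0 < n%:R :> R by rewrite ltr0n.
have nn : n%:R < n.+1%:R :> R by rewrite ltr_nat.
have dp (z : R) : n%:R <= z -> is_derive z 1 (fun x => x `^ (- e)) (- e * z `^ (- e - 1)).
  by move=> nz; apply: is_derive1_powR; exact: lt_le_trans nz.
have cp : {within `[n%:R, n.+1%:R : R], continuous (fun x : R => x `^ (- e))}.
  apply: derivable_within_continuous => z; rewrite in_itv/= => /andP[nz _].
  by have h := dp z nz; exact: ex_derive.
have dp' (z : R) : z \in `]n%:R, n.+1%:R[%R ->
    is_derive z 1 (fun x => x `^ (- e)) (- e * z `^ (- e - 1)).
  by rewrite in_itv/= => /andP[nz _]; apply: dp; exact: ltW.
have [z] := MVT nn dp' cp; rewrite in_itv/= => /andP[nz zn].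
have -> : n.+1%:R - n%:R = 1 :> R by rewrite -natr1 addrC addKr.
rewrite mulr1 => E; rewrite -[leRHS]opprK -mulrN opprB E mulNr mulrN opprK mulKf ?gt_eqF//.
have -> : - e - 1 = - (1 + e) by ring.
have z0 : 0 < z by exact: lt_trans nz.
rewrite !powRN lef_pV2 ?posrE ?powR_gt0//.
apply: ge0_ler_powR; rewrite ?nnegrE ?ltW// addr_gt0//.
Qed.

Lemma cvg_series_powR (e : R) : 0 < e ->
  cvgn (series (fun n => n%:R `^ (- (1 + e)) : R)).
Proof.
move=> e0; apply: nondecreasing_is_cvgn.
  by apply: nondecreasing_series => n _ _; exact: powR_ge0.
exists (1 + e^-1) => _ [n _ <-].
(* Telescoping starts at 1, so the first two terms are explicit: the one at 0 vanishes, because 0 to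
   a nonzero power is 0, and the one at 1 is 1. *)
have key m : series (fun n => n%:R `^ (- (1 + e)) : R) m.+2 <= 1 + e^-1 * (1 - m.+1%:R `^ (- e)).
  elim: m => [|m IH].
    rewrite /series/= !big_nat_recl//= big_geq// powR0; last by rewrite oppr_eq0 gt_eqF// addr_gt0.
    by rewrite !powR1 subrr mulr0 !addr0 add0r.
  rewrite seriesSr; apply: (le_trans (lerD IH (powR_telescope e0 (ltn0Sn m)))).
  by rewrite -addrA -mulrDr lerD2l ler_pM2l ?invr_gt0//; lra.
apply: (@le_trans _ _ (series (fun n => n%:R `^ (- (1 + e)) : R) n.+2)).
  rewrite !seriesSr -addrA lerDl addr_ge0// powR_ge0//.
apply: (le_trans (key n)); rewrite lerD2l ler_piMr ?invr_ge0 ?ltW// lerBlDr lerDl powR_ge0//.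
Qed.

End p_series.

(** * Assembling the facts about one eigenfunction *)

Section eigenfunction_fourier.
Context (R : realType).
Local Notation mu := (@lebesgue_measure R).
Local Notation I := (`]0, (pi : R)[%classic : set R).

(** The estimate on a half period extends to every [x] because the wave and [cos (n x)] are both
    unchanged by folding the argument into that half period. *)
Lemma fucik_wave_near_cos (n : nat) (a b A B x : R) : (0 < n)%N -> fucik_Gamma n a b ->
  0 < A -> 0 < B -> A * Num.sqrt a = B * Num.sqrt b -> Num.max A B = 1 ->
  `|fucik_wave n (fucik_profile (Num.sqrt a) (Num.sqrt b)
      (pi / (2 * Num.sqrt a)) (pi / n%:R) A B) x - cos (n%:R * x)|
    <= (2 + pi) * ((Num.max (Num.sqrt a) (Num.sqrt b) - n%:R) / n%:R).
Proof.
move=> n0 Gab A0 B0 AB AB1.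
have [[ra0 rb0] ras rbhs nh E] := fucik_Gamma_half_periods n0 Gab.
have nR0 : 0 < n%:R :> R by rewrite ltr0n.
have [h1 h2 h3 h4] := fucik_parameters_near nR0 ra0 rb0 A0 B0 E AB AB1.
have := fucik_profile_near_cos ra0 rb0 ras rbhs nh (fucik_wave_arg x n0) h1 h2 h3 h4.
by rewrite [X in cos X]mulrC divfK ?gt_eqF// cos_triangle_wave.
Qed.

(** [W] stands in for [f] because it is continuous on the whole line. *)
Lemma fucik_eigenfunction_fourier (n : nat) (a b : R) (f : R -> R) : (0 < n)%N ->
  fucik_Gamma n a b -> fucik_eigenfunction a b f ->
  exists W : R -> R, [/\ continuous W, forall x, 0 < x < pi -> f x = W x,
    forall m, (0 < m < n)%N -> \int[mu]_(x in I) (W x * cos (m%:R * x)) = 0,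
    0 < \int[mu]_(x in I) (W x * cos (n%:R * x))
  & forall x, `|W x - cos (n%:R * x)|
      <= (2 + pi) * ((Num.max (Num.sqrt a) (Num.sqrt b) - n%:R) / n%:R)].
Proof.
move=> n0 G feig.
have [[ra0 rb0] ras rbhs _ _] := fucik_Gamma_half_periods n0 G.
have [A [B [A0 B0 AB AB1 fW]]] := fucik_eigenfunction_wave n0 G feig.
exists (fucik_wave n (fucik_profile (Num.sqrt a) (Num.sqrt b)
  (pi / (2 * Num.sqrt a)) (pi / n%:R) A B)); split.
- exact/fucik_wave_continuous/fucik_profile_continuous.
- by move=> x /andP[x0 xp]; apply: fW; rewrite !ltW.
- by move=> m mn; apply: Rintegral_wave_cos_lt => //; exact: fucik_profile_continuous.
- apply: Rintegral_wave_cos_gt0 => //; first exact: fucik_profile_continuous.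
  exact: fucik_profile_decreasing.
- by move=> x; exact: fucik_wave_near_cos.
Qed.

End eigenfunction_fourier.

Theorem corollary1p6 (R : realType) (alpha beta : nat -> R)
    (f : nat -> R -> R) (C eps : R) :
  fucik_system alpha beta f ->
  0 < C -> 0 < eps ->
  (forall n : nat, (1 <= n)%N ->
    Num.max (Num.sqrt (alpha n)) (Num.sqrt (beta n))
      <= n%:R + C * n%:R `^ ((1 - eps) / 2)) ->
  riesz_basis (@L2_dot _ _ R (lebesgue_0pi R)) (fun n => L2_0pi_of (f n)).
Proof.
move=> [_ Gab f0 feig] C0 e0 bound.
have pi0 := pi_gt0 R.
have c0 := cos_coef_gt0 R 1.
have F0 : L2_0pi_of (f 0%N) = (cos_coef R 1)^-1 *: cos_basis R 0.
  rewrite -L2_0pi_of_cst_cos_basis; apply: eq_L2_0pi_of => x /andP[x0 xp].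
  by apply: f0; rewrite in_itv/= !ltW.
have wave n (n0 : (0 < n)%N) := fucik_eigenfunction_fourier n0 (Gab n n0) (feig n n0).
apply: (@riesz_basis_triangular_perturbation R (L2_0pi R) _ (@L2_normE _ _ R (lebesgue_0pi R))
  (cos_basis R) (@cos_basis_orthonormal R) _ (cos_coef R 1)^-1).
- exact: cos_basis_total.
- by rewrite invr_eq0 gt_eqF.
- exact: F0.
- pose K := (cos_coef R 1 * ((2 + pi) * C)) ^+ 2 * pi.
  have K0 : 0 <= K by rewrite mulr_ge0 ?sqr_ge0// ltW.
  apply: (@series_le_cvg _ _ (fun n => K * n%:R `^ (- (1 + eps)))).
  + by move=> n; exact: sqr_ge0.
  + by move=> n; rewrite mulr_ge0// powR_ge0.
  (* At index 0 the left-hand side is exactly zero, so any nonnegative majorant will do. *)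
  + move=> n; have [->|n0] := posnP n.
      rewrite F0 scalerA mulVf ?invr_eq0 ?gt_eqF// scale1r subrr normr0 expr0n.
      by rewrite mulr_ge0// powR_ge0.
    have [W [cW fW _ _ Wn]] := wave n n0.
    have nR0 : 0 < n%:R :> R by rewrite ltr0n.
    have n1 (r s : R) : n%:R `^ r * n%:R `^ s = n%:R `^ (r + s).
      by rewrite powRD// (lt0r_neq0 nR0) implybT.
    pose t := n%:R `^ (- (1 + eps) / 2).
    have tt : t ^+ 2 = n%:R `^ (- (1 + eps)) by rewrite expr2 /t n1; congr (_ `^ _); field.
    have tn : t * n%:R = n%:R `^ ((1 - eps) / 2).
      by rewrite -[X in t * X](powRr1 (ltW nR0)) /t n1; congr (_ `^ _); field.
    rewrite invrK (eq_L2_0pi_of fW) -tt.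
    have -> : K * t ^+ 2 = (cos_coef R 1 * ((2 + pi) * (C * t))) ^+ 2 * pi by rewrite /K; ring.
    apply: norm_L2_0pi_of_sub_cos_basis => // x; apply: (le_trans (Wn x)).
    rewrite ler_pM2l ?ler_pdivrMr//; last by apply: addr_gt0 => //; exact: pi0.
    by rewrite lerBlDl -mulrA tn; exact: bound.
  + by apply: is_cvg_seriesZ; exact: cvg_series_powR.
- move=> m n mn; have /andP[m0 nm] := mn.
  have [W [cW fW Wm _ _]] := wave n (ltn_trans m0 nm).
  by rewrite (eq_L2_0pi_of fW) [LHS]L2_dot_of_cos_basis// Wm ?mulr0.
- move=> n n0; have [W [cW fW _ Wn _]] := wave n n0.
  by rewrite (eq_L2_0pi_of fW) gt_eqF// [ltRHS]L2_dot_of_cos_basis// mulr_gt0// cos_coef_gt0.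
Qed.
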